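(* Let $K,L>0$, $r\in(0,2]$, $m,n\ge2$, $1\le p\le2$, $1\le q<\infty$, $A=(a_{ij})$ a real $m\times n$ matrix, and let $X=(X_{ij})_{i\le m,j\le n}$ have independent mean-zero entries with $\mathbb{P}(|X_{ij}|\ge t)\le Ke^{-t^r/L}$ for all $t\ge0$. Then $$\mathbb{E}\|X_A\colon\ell_p^n\to\ell_q^m\|\le C(r,K,L)\Big[q^{1/r}(\ln n)^{1/p^*}\|A\circ A\colon\ell^n_{p/2}\to\ell^m_{q/2}\|^{1/2}+(\ln n)^{1/2+1/p^*}\ln(mn)^{1/r}\|(A\circ A)^T\colon\ell^m_{q^*/2}\to\ell^n_{p^*/2}\|^{1/2}\Big],$$ where $C(r,K,L)$ depends only on $r,K,L$.
   Context: $X_A=(a_{ij}X_{ij})$, $A\circ A=(a_{ij}^2)$, $p^*$ Hölder conjugate of $p$. $\ell_s^n$ is $\mathbb{R}^n$ with $\|x\|_s=(\sum|x_j|^s)^{1/s}$ ($\max$ for $s=\infty$; quasi-norm for $s<1$), $\|B\colon\ell_s^n\to\ell_t^m\|=\sup_{\|x\|_s\le1}\|Bx\|_t$. *)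

(* Defs.v *)
From HB Require Import structures.
From mathcomp Require Import all_boot all_order all_algebra.
From mathcomp Require Import all_classical all_reals all_analysis.
Set Implicit Arguments. Unset Strict Implicit. Unset Printing Implicit Defensive.
Import Order.TTheory GRing.Theory Num.Theory.
Local Open Scope ring_scope.
Local Open Scope classical_set_scope.

(* Exponents s in (0, +oo] are elements of \bar R; s = +oo gives the max norm.
   For finite s, ||x||_s = (sum |x_j|^s)^(1/s) (a quasi-norm when s < 1). *)
Definition lnorm (R : realType) (n : nat) (s : \bar R) (x : 'I_n -> R) : R :=
  match s with
  | EFin s' => powR (\sum_(j < n) powR `|x j| s') (s'^-1)
  | _ => \big[Num.max/0]_(j < n) `|x j|
  end.

Definition mxapp (R : realType) (m n : nat) (B : 'M[R]_(m, n)) (x : 'I_n -> R)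
  : 'I_m -> R := fun i => \sum_(j < n) B i j * x j.

Definition opnorm (R : realType) (m n : nat) (s t : \bar R) (B : 'M[R]_(m, n))
  : \bar R :=
  ereal_sup [set (lnorm t (mxapp B x))%:E | x in [set x | lnorm s x <= 1]].

Definition hconj (R : realType) (p : R) : \bar R :=
  if p == 1 then +oo%E else (p / (p - 1))%:E.

Definition ehalf (R : realType) (s : \bar R) : \bar R := (s * (2^-1)%:E)%E.

Definition hsq (R : realType) (m n : nat) (A : 'M[R]_(m, n)) : 'M[R]_(m, n) :=
  \matrix_(i, j) (A i j ^+ 2).

Definition XA (d : measure_display) (T : measurableType d) (R : realType)
  (m n : nat) (A : 'M[R]_(m, n)) (X : 'I_m -> 'I_n -> T -> R) (w : T)
  : 'M[R]_(m, n) := \matrix_(i, j) (A i j * X i j w).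

(* mutual independence of a finite family of real random variables:
   the product rule for every choice of Borel sets (taking B k = setT for
   unused indices covers all subfamilies) *)
Definition mutually_independent (d : measure_display) (T : measurableType d)
  (R : realType) (P : probability T R) (I : finType) (Y : I -> T -> R) : Prop :=
  forall B : I -> set R, (forall k, measurable (B k)) ->
    P (\bigcap_(k in [set: I]) (Y k @^-1` B k)) =
    (\prod_(k : I) P (Y k @^-1` B k))%E.

(* Main.v *)
Require Import Defs.
From HB Require Import structures.
From mathcomp Require Import all_boot all_order all_algebra.
From mathcomp Require Import all_classical all_reals all_analysis.
From mathcomp Require Import measurable_realfun ring lra.
Set Implicit Arguments. Unset Strict Implicit. Unset Printing Implicit Defensive.
Import Order.TTheory GRing.Theory Num.Theory.
Local Open Scope ring_scope.
Local Open Scope classical_set_scope.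

(** For a fixed vector [x], even moments of the linear forms [(X_A x)_i] give
    [E ||X_A x||_q <= C q^(1/r) D1 ||x||_p] with [D1] the square root of the first
    norm on the right-hand side.  Up to the factor [(1 + ln n)^(1 - 1/p)], the unit ball
    of [l_p^n] lies in the convex hull of the normalised sign vectors
    [k^(-1/p) (0, +-1)].  For such a vector with [k] nonzero coordinates,
    [y |-> ||Y_A x||_q] is convex and Lipschitz with constant [D2 / sqrt k] ([D2] the
    square root of the second norm), so Maurey's property (tau) for independent
    variables bounded by [M] gives Gaussian deviations at scale [M D2 / sqrt k], which
    survives a union bound over the at most [(2n)^k] vectors at the price of
    [sqrt (ln n) M D2].  Truncating the entries at [M ~ ln(mn)^(1/r)] and rounding them
    to a grid of step [1/(mn)] costs only [O(D2)], and turns their joint law into a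
    finite product, on which expectations are finite sums. *)

(** * Elementary inequalities *)

(** The mean and the fluctuations use the entries differently. The mean of [||Y_A x||_q] uses only
    moments, bounded uniformly in the truncation level, so no power of [ln(mn)] multiplies [D1];
    boundedness by [M] is spent on the fluctuations alone, which involve only [D2]. For [k] nonzero
    signs the squared Lipschitz constant is [k^(2/p - 1) D2^2]. The normalisation leaves [D2^2 / k],
    and this [1/k] matches the [k ln n] of the union bound, so all [k] are handled at one common
    scale. Truncation destroys centring, so the rounded entries are recentred. The remaining error,
    of order [1/(mn)] per entry in mean, is summed crudely over the [mn] entries, using that each
    [|a_ij|] is at most [D2]. The supremum over the unit ball is never integrated by itself: it is
    dominated by an explicit majorant of the rounded entries, which takes finitely many values and
    is therefore measurable, plus the error. *)

Section Elementary.
Variable R : realType.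
Implicit Types (a b t u x : R).

Lemma powR_young a b t : 0 <= a -> 0 <= b -> 0 <= t -> t <= 1 ->
  a `^ t * b `^ (1 - t) <= t * a + (1 - t) * b.
Proof.
move=> a0 b0 t0 t1.
have [->|tn0] := eqVneq t 0.
  by rewrite powRr0 subr0 powRr1// mul0r add0r !mul1r.
have [->|tn1] := eqVneq t 1.
  by rewrite powRr1// subrr powRr0 mul0r addr0 mulr1 mul1r.
have tp : 0 < t by rewrite lt_neqAle eq_sym tn0.
have t1p : 0 < 1 - t by rewrite subr_gt0 lt_neqAle tn1.
have := @conjugate_powR R (a `^ t) (b `^ (1 - t)) t^-1 (1 - t)^-1
  (powR_ge0 _ _) (powR_ge0 _ _).
rewrite !invr_gt0 !invrK => /(_ tp t1p); rewrite addrC subrK => /(_ erefl).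
by rewrite -!powRrM !divff ?gt_eqF// !powRr1// ![_ * a]mulrC ![_ * b]mulrC.
Qed.

(** Young's inequality applied to [f i / F] and [g i / G], with [F] and [G] the totals. The
    endpoints [t = 0] and [t = 1] are included so that [p = 1] needs no separate treatment in
    [norm_le_sign_vectors]. *)
Lemma holder_sum (I : finType) (P : pred I) (f g : I -> R) t :
  (forall i, 0 <= f i) -> (forall i, 0 <= g i) -> 0 <= t -> t <= 1 ->
  \sum_(i | P i) f i `^ t * g i `^ (1 - t) <=
  (\sum_(i | P i) f i) `^ t * (\sum_(i | P i) g i) `^ (1 - t).
Proof.
move=> f0 g0 t0 t1.
have [->|tn0] := eqVneq t 0.
  rewrite !powRr0 subr0 mul1r powRr1 ?sumr_ge0//.
  by apply: ler_sum => i _; rewrite powRr0 mul1r powRr1.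
have [->|tn1] := eqVneq t 1.
  rewrite subrr !powRr0 mulr1 powRr1 ?sumr_ge0//.
  by apply: ler_sum => i _; rewrite powRr0 mulr1 powRr1.
have tp : 0 < t by rewrite lt_neqAle eq_sym tn0.
have t1p : 0 < 1 - t by rewrite subr_gt0 lt_neqAle tn1.
set F := \sum_(i | P i) f i; set G := \sum_(i | P i) g i.
have F0 : 0 <= F by exact: sumr_ge0.
have G0 : 0 <= G by exact: sumr_ge0.
have [F00|Fn0] := eqVneq F 0.
  rewrite big1 ?mulr_ge0 ?powR_ge0// => i Pi.
  have -> : f i = 0.
    by apply/eqP; move: F00 => /eqP; rewrite psumr_eq0// => /allP/(_ i);
      rewrite mem_index_enum => /(_ isT); rewrite Pi.
  by rewrite powR0 ?mul0r.
have [G00|Gn0] := eqVneq G 0.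
  rewrite big1 ?mulr_ge0 ?powR_ge0// => i Pi.
  have -> : g i = 0.
    by apply/eqP; move: G00 => /eqP; rewrite psumr_eq0// => /allP/(_ i);
      rewrite mem_index_enum => /(_ isT); rewrite Pi.
  by rewrite (@powR0 _ (1 - t)) ?mulr0// gt_eqF.
have Fp : 0 < F by rewrite lt_neqAle eq_sym Fn0.
have Gp : 0 < G by rewrite lt_neqAle eq_sym Gn0.
have H i : f i `^ t * g i `^ (1 - t) <=
    F `^ t * G `^ (1 - t) * (t * (f i / F) + (1 - t) * (g i / G)).
  rewrite -{1}[f i](divfK Fn0) -{1}[g i](divfK Gn0).
  rewrite (@powRM _ (f i / F) F) ?(@powRM _ (g i / G) G) ?divr_ge0//.
  rewrite mulrACA [leLHS]mulrC.
  apply: ler_wpM2l; first by rewrite mulr_ge0 ?powR_ge0.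
  by apply: powR_young => //; rewrite divr_ge0.
apply: (le_trans (ler_sum _ (fun i _ => H i))).
rewrite -mulr_sumr big_split/= -!mulr_sumr -!mulr_suml -/F -/G !divff//.
by rewrite !mulr1 addrC subrK mulr1.
Qed.

Lemma le_powR2r a b t : 0 <= t -> 0 <= a -> a <= b -> a `^ t <= b `^ t.
Proof.
by move=> t0 a0 ab; apply: ge0_ler_powR => //; rewrite nnegrE// (le_trans a0).
Qed.

(** Hölder between [w * z] and [w]: the weights recombine through [w^t * w^(1 - t) = w]. *)
Lemma powR_jensen (I : finType) (w z : I -> R) t :
  (forall i, 0 <= w i) -> \sum_i w i = 1 -> (forall i, 0 <= z i) ->
  0 <= t -> t <= 1 -> \sum_i w i * z i `^ t <= (\sum_i w i * z i) `^ t.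
Proof.
move=> w0 w1 z0 t0 t1.
have := @holder_sum I xpredT (fun i => w i * z i) w t
  (fun i => mulr_ge0 (w0 i) (z0 i)) w0 t0 t1.
rewrite w1 powR1 mulr1; apply: le_trans; apply: ler_sum => i _.
rewrite powRM// mulrAC.
have [->|wn0] := eqVneq (w i) 0.
  by rewrite mul0r mulr_ge0 ?mulr_ge0 ?powR_ge0.
by rewrite -powRD ?wn0 ?implybT// addrC subrK powRr1.
Qed.

Lemma expR_half_le2 : expR (2^-1) <= 2 :> R.
Proof.
have := expR_ge1Dx (- 2^-1 : R); rewrite expRN => h.
rewrite -[expR _]invrK -[leRHS]invrK lef_pV2 ?posrE ?invr_gt0 ?expR_gt0//.
by lra.
Qed.

(** Serves to absorb additive constants into logarithms, as in [1 + ln n <= 3 * ln n]. *)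
Lemma ln_ge_half (n : nat) : (2 <= n)%N -> 2^-1 <= ln (n%:R : R).
Proof.
move=> n2; rewrite -[leLHS]expRK ler_ln ?posrE ?expR_gt0 ?ltr0n//; last first.
  exact: ltn_trans n2.
by apply: (le_trans expR_half_le2); rewrite (ler_nat R 2).
Qed.

Lemma ln_ge_one (n : nat) : (4 <= n)%N -> 1 <= ln (n%:R : R).
Proof.
move=> n4; rewrite -[leLHS]expRK ler_ln ?posrE ?expR_gt0 ?ltr0n//; last first.
  exact: leq_trans n4.
rewrite [X in expR X](_ : 1 = 2^-1 + 2^-1); last by lra.
rewrite expRD; apply: (@le_trans _ _ (2 * 2)).
  by apply: ler_pM; rewrite ?expR_ge0// expR_half_le2.
by rewrite -natrM (ler_nat R (2 * 2)).
Qed.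

(** Each new term satisfies [1/(n+2) <= - ln (1 - 1/(n+2)) = ln ((n+2)/(n+1))], so the sum
    telescopes. *)
Lemma harmonic_le_ln (n : nat) : (0 < n)%N ->
  \sum_(i < n) i.+1%:R^-1 <= 1 + ln (n%:R : R).
Proof.
case: n => // n _; elim: n => [|n IH].
  by rewrite big_ord_recr big_ord0/= add0r invr1 ln1 addr0.
rewrite big_ord_recr/=; apply: (le_trans (lerD IH (lexx _))).
rewrite -addrA lerD2l -lerBrDl -ln_div ?posrE ?ltr0n//.
have -> : n.+2%:R / n.+1%:R = (1 + - n.+2%:R^-1)^-1 :> R.
  have h : (n.+1%:R : R) != 0 by rewrite pnatr_eq0.
  have h2 : (n.+2%:R : R) != 0 by rewrite pnatr_eq0.
  have e : (n.+1%:R : R) = n.+2%:R - 1 by rewrite -[in RHS]natr1 addrK.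
  move: h h2; rewrite e; move: (n.+2%:R : R) => x h h2.
  by field; rewrite ?h ?h2.
rewrite lnV; last first.
  by rewrite posrE subr_gt0 invf_lt1 ?ltr0n// ltr1n.
by rewrite -[leLHS]opprK lerN2; apply: le_ln1Dx; rewrite ltrN2 invf_lt1 ?ltr0n// ltr1n.
Qed.

(* With [t = 2u] (capped at 1) the exponent is [u - (7/4) u^2], small enough to
   compensate the second-order term of [2 - expR (- u)]. *)
Lemma expR_tradeoff u : 0 <= u -> exists t,
  [/\ 0 <= t, t <= 1 & expR ((1 - t) * u + t ^+ 2 / 16) <= 2 - expR (- u)].
Proof.
move=> u0.
have eV x : x < 1 -> expR x <= (1 - x)^-1.
  move=> x1; rewrite -[expR x]invrK -expRN lef_pV2 ?posrE ?expR_gt0 ?subr_gt0//.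
  exact: expR_ge1Dx.
(* The square is essential. With [1 / (1 + u)] the right-hand side would only be [1 + u - u^2] to
   second order, below the [1 + u - (3/4) u^2] that [eV] gives on the left. The squared form yields
   [3/4] exactly, and the difference starts at order [u^3]. *)
have eN x : 0 <= x -> expR (- x) <= ((1 + x / 2) ^+ 2)^-1.
  move=> x0; have -> : - x = (- x / 2) + (- x / 2) by lra.
  have le1 : expR (- x / 2) <= (1 + x / 2)^-1.
    by apply: le_trans (eV _ _) _; [lra|rewrite (_ : 1 - _ = 1 + x / 2)//; lra].
  by rewrite expRD -exprVn expr2; apply: ler_pM; rewrite ?expR_ge0.
have [uh|uh] := leP u 2^-1.
  exists (2 * u); split; [lra|lra|].
  set w := (_ + _); have w1 : w < 1 by rewrite /w; nra.
  have P0 : 0 < (1 + u / 2) ^+ 2 by apply: exprn_gt0; lra.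
  have Q0 : 0 < 1 - w by lra.
  apply: (le_trans (eV _ w1)); rewrite lerBrDr.
  apply: (le_trans (lerD (lexx _) (eN _ u0))).
  rewrite -[X in X + _]div1r -[X in _ + X]div1r addf_div ?gt_eqF//; try lra.
  rewrite ler_pdivrMr ?mulr_gt0// /w; try lra.
  have u3 : 0 <= u ^+ 3 by exact: exprn_ge0.
  have u4 : 0 <= u ^+ 4 by exact: exprn_ge0.
  rewrite -subr_ge0; set e := (X in 0 <= X).
  have -> : e = 3 * u ^+ 3 + 7 / 8 * u ^+ 4 by rewrite /e; field.
  by lra.
(* For [u > 1/2] the cap [t = 1] suffices: [16/15 + 16/25 = 128/75 < 2]. *)
exists 1; split => //; rewrite subrr mul0r add0r expr1n.
have h1 : expR (1 / 16) <= 16 / 15 :> R.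
  apply: le_trans (eV _ _) _; first lra.
  by rewrite le_eqVlt; apply/orP; left; apply/eqP; field.
have h2 : expR (- u) <= 16 / 25 :> R.
  apply: (@le_trans _ _ (expR (- 2^-1))); first by rewrite ler_expR; lra.
  apply: le_trans (eN _ _) _; first by lra.
  by rewrite le_eqVlt; apply/orP; left; apply/eqP; field.
lra.
Qed.
End Elementary.

(** * Property (tau) and convex concentration on finite products *)

Section ProductExpectation.
Variables (R : realType) (I : choiceType) (S : finType).
Variables (mu v : I -> S -> R).
Hypothesis mu_ge0 : forall k s, 0 <= mu k s.
Hypothesis mu_sum1 : forall k, \sum_s mu k s = 1.
Implicit Types (y z : I -> R) (F G : (I -> R) -> R) (ks : seq I).

Definition upd y k t : I -> R := fun j => if j == k then t else y j.

(* The coordinates in [ks] are integrated out against the laws giving mass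
   [mu k s] to the point [v k s]; the others are read off [y]. *)
Fixpoint expect ks F y : R :=
  if ks is k :: ks' then \sum_s mu k s * expect ks' F (upd y k (v k s))
  else F y.

Lemma updC y k l a b : k != l -> upd (upd y k a) l b = upd (upd y l b) k a.
Proof.
by move=> kl; apply/funext => j; rewrite /upd; case: eqP => // ->;
  rewrite eq_sym (negbTE kl).
Qed.

Lemma upd_id y k : upd y k (y k) = y.
Proof. by apply/funext => j; rewrite /upd; case: eqP => // ->. Qed.

Lemma expect_le ks F G y :
  (forall z, (forall j, j \notin ks -> z j = y j) -> F z <= G z) ->
  expect ks F y <= expect ks G y.
Proof.
elim: ks y => [|k ks IH] y H /=; first exact: H.
apply: ler_sum => s _; apply: ler_wpM2l => //; apply: IH => z Hz.
apply: H => j; rewrite inE negb_or => /andP[jk jks].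
by rewrite Hz// /upd (negbTE jk).
Qed.

Lemma eq_expect ks F G y :
  (forall z, (forall j, j \notin ks -> z j = y j) -> F z = G z) ->
  expect ks F y = expect ks G y.
Proof.
by move=> H; apply/le_anti/andP; split; apply: expect_le => z Hz; rewrite H.
Qed.

Lemma expect_cst ks c y : expect ks (fun=> c) y = c.
Proof.
elim: ks y => //= k ks IH y.
by under eq_bigr do rewrite IH; rewrite -mulr_suml mu_sum1 mul1r.
Qed.

Lemma expectZ ks c F y : expect ks (fun z => c * F z) y = c * expect ks F y.
Proof.
elim: ks y => //= k ks IH y; rewrite mulr_sumr; apply: eq_bigr => s _.
by rewrite IH mulrCA.
Qed.

Lemma expectD ks F G y :
  expect ks (fun z => F z + G z) y = expect ks F y + expect ks G y.
Proof.
elim: ks y => //= k ks IH y; rewrite -big_split/=; apply: eq_bigr => s _.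
by rewrite IH mulrDr.
Qed.

Lemma expect_sum ks (J : finType) (P : pred J) (F : J -> (I -> R) -> R) y :
  expect ks (fun z => \sum_(j | P j) F j z) y = \sum_(j | P j) expect ks (F j) y.
Proof.
elim: ks y => //= k ks IH y; rewrite exchange_big/=; apply: eq_bigr => s _.
by rewrite IH mulr_sumr.
Qed.

Lemma expect_ge0 ks F y : (forall z, 0 <= F z) -> 0 <= expect ks F y.
Proof. by move=> F0; rewrite -(expect_cst ks 0 y); apply: expect_le => z _. Qed.

Lemma expect_gt0 ks F y : (forall z, 0 < F z) -> 0 < expect ks F y.
Proof.
move=> F0; elim: ks y => //= k ks IH y.
have Fs s : 0 <= mu k s * expect ks F (upd y k (v k s)).
  by rewrite mulr_ge0// ltW.
rewrite lt_neqAle sumr_ge0 ?andbT//; apply/negP => /eqP/esym/eqP.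
rewrite psumr_eq0// => /allP H.
have : \sum_s mu k s = 0.
  apply: big1 => s _; have := H s; rewrite mem_index_enum => /(_ isT)/=.
  by rewrite mulf_eq0 (gt_eqF (IH _)) orbF => /eqP.
by rewrite mu_sum1 => /eqP; rewrite oner_eq0.
Qed.

(** Averaging this tangent line, at a mean or at a convex combination, gives both Jensen's
    inequality and the convexity of the exponential. *)
Lemma expR_tangent (c x : R) : expR c * (1 + (x - c)) <= expR x.
Proof.
rewrite -[in leRHS](subrK c x) expRD mulrC.
by apply: ler_wpM2r; rewrite ?expR_ge0// expR_ge1Dx.
Qed.

Lemma expR_expect_le ks F y : expR (expect ks F y) <= expect ks (fun z => expR (F z)) y.
Proof.
set m := expect ks F y.
have : expR m * expect ks (fun z => 1 + (F z - m)) y <= expect ks (fun z => expR (F z)) y.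
  by rewrite -expectZ; apply: expect_le => z _; exact: expR_tangent.
by rewrite !expectD !expect_cst subrr addr0 mulr1.
Qed.

Lemma expect_powR_le ks F y t : (forall z, 0 <= F z) -> 0 <= t -> t <= 1 ->
  expect ks (fun z => F z `^ t) y <= (expect ks F y) `^ t.
Proof.
move=> F0 t0 t1; elim: ks y => //= k ks IH y.
have J := powR_jensen (mu_ge0 k) (mu_sum1 k)
  (fun s => expect_ge0 ks (upd y k (v k s)) F0) t0 t1.
by apply: le_trans J; apply: ler_sum => s _; apply: ler_wpM2l.
Qed.

Definition convexf F := forall y z t, 0 <= t -> t <= 1 ->
  F (fun j => (1 - t) * y j + t * z j) <= (1 - t) * F y + t * F z.

Lemma upd_conv y z t k a b :
  upd (fun j => (1 - t) * y j + t * z j) k ((1 - t) * a + t * b) =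
  (fun j => (1 - t) * upd y k a j + t * upd z k b j).
Proof. by apply/funext => j; rewrite /upd; case: eqP. Qed.

Lemma expR_conv (a b t : R) : 0 <= t -> t <= 1 ->
  expR ((1 - t) * a + t * b) <= (1 - t) * expR a + t * expR b.
Proof.
move=> t0 t1; set c := (X in expR X).
have t1' : 0 <= 1 - t by lra.
apply: le_trans (lerD (ler_wpM2l t1' (expR_tangent c a)) (ler_wpM2l t0 (expR_tangent c b))).
by rewrite le_eqVlt; apply/orP; left; apply/eqP; rewrite /c; ring.
Qed.

(** Log-sum-exp preserves convexity, by Hölder. The terms are divided by the totals [A] and [B] at
    the two endpoints, so that convexity of the exponential can be summed against weights of total
    mass one. The integrated coordinate has the same value at both endpoints, hence also at the
    intermediate point. *)
Lemma ln_expect_convex ks F : convexf F ->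
  convexf (fun y => ln (expect ks (fun z => expR (F z)) y)).
Proof.
move=> cF; elim: ks => [|k ks IH] y z t t0 t1 /=.
  by rewrite !expRK; exact: cF.
set E := expect ks _ in IH *.
have E0 x : 0 < E x by apply: expect_gt0 => ?; exact: expR_gt0.
have S0 x : 0 < \sum_s mu k s * E (upd x k (v k s)).
  exact: (expect_gt0 (k :: ks) x (fun z => expR_gt0 (F z))).
set A := \sum_s mu k s * E (upd y k (v k s)).
set B := \sum_s mu k s * E (upd z k (v k s)).
have A0 : 0 < A by exact: S0.
have B0 : 0 < B by exact: S0.
set c := (1 - t) * _ + _.
have step s : E (upd (fun j => (1 - t) * y j + t * z j) k (v k s)) <=
    expR c * ((1 - t) * (E (upd y k (v k s)) / A) + t * (E (upd z k (v k s)) / B)).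
  set Ea := E (upd y k _); set Eb := E (upd z k _).
  have Ea0 : 0 < Ea by exact: E0.
  have Eb0 : 0 < Eb by exact: E0.
  have := IH (upd y k (v k s)) (upd z k (v k s)) t t0 t1.
  rewrite -upd_conv (_ : (1 - t) * v k s + t * v k s = v k s); last by ring.
  rewrite -ler_expR lnK ?posrE// => /le_trans; apply.
  rewrite -/Ea -/Eb.
  have -> : (1 - t) * ln Ea + t * ln Eb =
    c + ((1 - t) * (ln Ea - ln A) + t * (ln Eb - ln B)) by rewrite /c; ring.
  rewrite expRD; apply: ler_wpM2l; first exact: expR_ge0.
  apply: (le_trans (expR_conv _ _ t0 t1)).
  by rewrite !expRD !expRN !lnK ?posrE.
rewrite -[c]expRK ler_ln ?posrE ?expR_gt0//.
apply: (le_trans (ler_sum _ (fun s _ => ler_wpM2l (mu_ge0 k s) (step s)))).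
rewrite (eq_bigr (fun s => expR c * ((1 - t) * (mu k s * E (upd y k (v k s)) / A) +
  t * (mu k s * E (upd z k (v k s)) / B)))); last by move=> s _; ring.
rewrite -mulr_sumr big_split/= -!mulr_sumr -!mulr_suml -/A -/B.
by rewrite !divff ?gt_eqF// !mulr1 subrK mulr1.
Qed.

Lemma expect_shift ks F G k y (a b c : R) : k \notin ks ->
  (forall z, z k = a -> F z <= c * G (upd z k b)) ->
  expect ks F (upd y k a) <= c * expect ks G (upd y k b).
Proof.
move=> kks H; elim: ks y kks => [|l ks IH] y /=.
  move=> _; have := H (upd y k a); rewrite {1}/upd eqxx => /(_ erefl).
  by congr (_ <= _ * G _); apply/funext => j; rewrite /upd; case: eqP.
rewrite inE negb_or => /andP[kl kks]; rewrite mulr_sumr.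
apply: ler_sum => s _; rewrite mulrCA; apply: ler_wpM2l => //.
by rewrite !(updC _ _ _ kl); exact: IH.
Qed.

(** * Infimal convolution with a quadratic cost *)

Variable kappa : R.
Hypothesis kappa_ge0 : 0 <= kappa.

(** Iterated over the coordinates this is the infimal convolution with [kappa] times the squared
    Euclidean distance. Taking one coordinate at a time matches the recursion of [expect]. *)
Definition infconv k F y : R :=
  inf [set F (upd y k t) + kappa * (y k - t) ^+ 2 | t in [set: R]].

Fixpoint infconvs ks F : (I -> R) -> R :=
  if ks is k :: ks' then infconv k (infconvs ks' F) else F.

Lemma infconv_has_lb k F y : (forall z, 0 <= F z) ->
  has_lbound [set F (upd y k t) + kappa * (y k - t) ^+ 2 | t in [set: R]].
Proof. by move=> F0; exists 0 => _ [t _ <-]; rewrite addr_ge0// mulr_ge0// sqr_ge0. Qed.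

Lemma infconv_le k F y t : (forall z, 0 <= F z) ->
  infconv k F y <= F (upd y k t) + kappa * (y k - t) ^+ 2.
Proof. by move=> F0; apply: ge_inf; [exact: infconv_has_lb|exists t]. Qed.

Lemma le_infconv k F y b :
  (forall t, b <= F (upd y k t) + kappa * (y k - t) ^+ 2) -> b <= infconv k F y.
Proof.
move=> H; apply: lb_le_inf; last by move=> _ [t _ <-].
by exists (F (upd y k 0) + kappa * (y k - 0) ^+ 2), 0.
Qed.

(** Replaces an infimum on the larger side by an arbitrary competitor. Used twice in
    [infconv_convex], once for each endpoint. *)
Lemma le_affine_infconv k F y a b t : 0 <= t -> (forall z, 0 <= F z) ->
  (forall x, b <= a + t * (F (upd y k x) + kappa * (y k - x) ^+ 2)) ->
  b <= a + t * infconv k F y.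
Proof.
move=> t0 F0 H; have [t00|tn0] := eqVneq t 0.
  by have := H 0; rewrite t00 !mul0r.
have tp : 0 < t by rewrite lt_neqAle eq_sym tn0.
rewrite addrC -lerBlDr mulrC -ler_pdivrMr//; apply: le_infconv => x.
by rewrite ler_pdivrMr// lerBlDr addrC mulrC.
Qed.

Lemma infconv_ge0 k F : (forall z, 0 <= F z) -> forall z, 0 <= infconv k F z.
Proof. by move=> F0 z; apply: le_infconv => t; rewrite addr_ge0// mulr_ge0// sqr_ge0. Qed.

(** Partial minimisation of a jointly convex function. Competitors [a] and [b] are combined into
    [(1 - t) a + t b], and the convexity defect of the square is the nonnegative term
    [t (1 - t) ((y k - a) - (z k - b))^2]. *)
Lemma infconv_convex k F : (forall z, 0 <= F z) -> convexf F -> convexf (infconv k F).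
Proof.
move=> F0 cF y z t t0 t1; apply: (@le_affine_infconv k F z) => // b.
rewrite [leRHS]addrC; apply: (@le_affine_infconv k F y) => //; first by rewrite subr_ge0.
move=> a; apply: (le_trans (infconv_le _ _ ((1 - t) * a + t * b) F0)).
rewrite upd_conv; apply: (le_trans (lerD (cF _ _ _ t0 t1) (lexx _))).
rewrite -subr_ge0; set e := (X in 0 <= X).
have -> : e = kappa * (t * (1 - t) * ((y k - a) - (z k - b)) ^+ 2) by rewrite /e; ring.
by apply: mulr_ge0 => //; apply: mulr_ge0; [rewrite mulr_ge0// subr_ge0|exact: sqr_ge0].
Qed.

Lemma infconvs_ge0 ks F : (forall z, 0 <= F z) -> forall z, 0 <= infconvs ks F z.
Proof. by move=> F0; elim: ks => //= k ks IH; exact: infconv_ge0. Qed.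

Lemma infconvs_convex ks F : (forall z, 0 <= F z) -> convexf F -> convexf (infconvs ks F).
Proof.
by move=> F0 cF; elim: ks => //= k ks IH; apply: infconv_convex => //; exact: infconvs_ge0.
Qed.

(** Turns a bound against the full squared distance into one for the iterated infimum. This is how a
    Lipschitz hypothesis enters property (tau). *)
Lemma le_infconvs ks F y b : uniq ks ->
  (forall z, (forall j, j \notin ks -> z j = y j) ->
     b <= F z + kappa * \sum_(j <- ks) (y j - z j) ^+ 2) ->
  b <= infconvs ks F y.
Proof.
elim: ks b y => [|k ks IH] b y /=.
  by move=> _ /(_ y (fun _ _ => erefl)); rewrite big_nil mulr0 addr0.
move=> /andP[kks uks] H; apply: le_infconv => t.
rewrite -lerBlDr; apply: IH => // z zy.
have zk : z k = t by rewrite zy// /upd eqxx.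
rewrite lerBlDr; apply: (le_trans (H z _)).
  by move=> j; rewrite inE negb_or => /andP[jk jks]; rewrite zy// /upd (negbTE jk).
rewrite big_cons zk mulrDr addrA [leLHS]addrAC lerD2r// lerD2l ler_wpM2l//.
rewrite big_seq [leRHS]big_seq; apply: ler_sum => j jks.
by rewrite /upd; case: eqP kks => // <-; rewrite jks.
Qed.

(** * Property (tau) in one dimension *)

Section OneDimension.
Variables (w p : S -> R) (phi h : R -> R) (l : R).
Hypothesis w_ge0 : forall s, 0 <= w s.
Hypothesis w_sum1 : \sum_s w s = 1.
Hypothesis phi_convex : forall a b t, 0 <= t -> t <= 1 ->
  phi ((1 - t) * a + t * b) <= (1 - t) * phi a + t * phi b.
Hypothesis h_le : forall a b, h a <= phi b + kappa * (a - b) ^+ 2.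
Hypothesis p_diam : forall s s', (p s - p s') ^+ 2 <= l.
Hypothesis kappa_l : kappa * l <= 16^-1.

(** Let [p c] be an atom minimising [phi]. Moving from [p s] a fraction [t] of the way to [p c]
    bounds [h (p s) - phi (p c)] by [(1 - t) u + t^2 / 16], with [u] the excess of [phi] over its
    minimum. Choosing [t] by [expR_tradeoff], which is Talagrand's convex-distance inequality with a
    smaller constant, gives [exp (h - phi (p c)) <= 2 - exp (- u)]. After averaging, with [X] the
    mean of [exp (- u)], the claim is [(2 - X) X <= 1]. *)
Lemma tau_one_dim :
  (\sum_s w s * expR (h (p s))) * (\sum_s w s * expR (- phi (p s))) <= 1.
Proof.
have [s0 _] : exists s0 : S, true.
  case: (pickP (@predT S)) => [s _|S0]; first by exists s.
  by move: w_sum1; rewrite big_pred0// => /esym/eqP; rewrite oner_eq0.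
have [c _ cmin] := @Order.TotalTheory.arg_minP _ R S s0 xpredT (fun s => phi (p s)) isT.
pose u s := phi (p s) - phi (p c).
have u0 s : 0 <= u s by rewrite subr_ge0 cmin.
pose X := \sum_s w s * expR (- u s).
have H1 : \sum_s w s * expR (h (p s)) <= expR (phi (p c)) * (2 - X).
  rewrite -[2]mulr1 -{2}w_sum1 /X mulr_sumr -sumrB mulr_sumr; apply: ler_sum => s _.
  have [t [t0 t1 ht]] := expR_tradeoff (u0 s).
  rewrite [leRHS](_ : _ = w s * (expR (phi (p c)) * (2 - expR (- u s)))); last by ring.
  apply: ler_wpM2l => //; apply: (@le_trans _ _ (expR (phi (p c)) *
    expR ((1 - t) * u s + t ^+ 2 / 16))); last by apply: ler_wpM2l; rewrite ?expR_ge0.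
  rewrite -expRD ler_expR.
  apply: (le_trans (h_le _ ((1 - t) * p s + t * p c))).
  apply: (le_trans (lerD (phi_convex _ _ t0 t1) (lexx _))).
  have -> : p s - ((1 - t) * p s + t * p c) = t * (p s - p c) by ring.
  rewrite exprMn mulrCA.
  have : t ^+ 2 * (kappa * (p s - p c) ^+ 2) <= t ^+ 2 * 16^-1.
    apply: ler_wpM2l; first exact: sqr_ge0.
    by apply: le_trans kappa_l; apply: ler_wpM2l.
  rewrite /u; lra.
have H2 : \sum_s w s * expR (- phi (p s)) = expR (- phi (p c)) * X.
  rewrite /X mulr_sumr; apply: eq_bigr => s _.
  by rewrite mulrCA -expRD /u; congr (_ * expR _); ring.
have X0 : 0 <= X by apply: sumr_ge0 => s _; rewrite mulr_ge0// expR_ge0.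
rewrite H2; apply: (@le_trans _ _ (expR (phi (p c)) * (2 - X) * (expR (- phi (p c)) * X))).
  by apply: ler_wpM2r => //; rewrite mulr_ge0// expR_ge0.
rewrite mulrACA -expRD subrr expR0 mul1r.
by have := sqr_ge0 (X - 1); lra.
Qed.
End OneDimension.

Variable l : R.
Hypothesis v_diam : forall k s s', (v k s - v k s') ^+ 2 <= l.
Hypothesis kappa_l : kappa * l <= 16^-1.

(* Maurey's property (tau) for convex functions. The order of integration
   matters: [ln E e^{QF}] stays convex in the remaining variables, whereas
   [- ln E e^{-F}] need not. *)
Lemma tau_product ks F y : uniq ks -> (forall z, 0 <= F z) -> convexf F ->
  expect ks (fun z => expR (infconvs ks F z)) y * expect ks (fun z => expR (- F z)) y <= 1.
Proof.
move=> uks F0 cF; elim: ks y uks => [|k ks IH] y /=.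
  by rewrite -expRD subrr expR0.
move=> /andP[kks uks].
pose QF := infconvs ks F.
have QF0 : forall z, 0 <= QF z by exact: infconvs_ge0.
have cQF : convexf QF by exact: infconvs_convex.
pose phi t := ln (expect ks (fun z => expR (QF z)) (upd y k t)).
pose h t := ln (expect ks (fun z => expR (infconv k QF z)) (upd y k t)).
have ep z : 0 < expect ks (fun z => expR (QF z)) z.
  by apply: expect_gt0 => ?; exact: expR_gt0.
have eh z : 0 < expect ks (fun z => expR (infconv k QF z)) z.
  by apply: expect_gt0 => ?; exact: expR_gt0.
have phi_c a b t : 0 <= t -> t <= 1 ->
    phi ((1 - t) * a + t * b) <= (1 - t) * phi a + t * phi b.
  move=> t0 t1; have := ln_expect_convex ks cQF (upd y k a) (upd y k b) t0 t1.
  rewrite -upd_conv (_ : (fun j => _) = y)//.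
  by apply/funext => j; ring.
have h_le a b : h a <= phi b + kappa * (a - b) ^+ 2.
  rewrite -ler_expR expRD !lnK ?posrE// mulrC.
  apply: expect_shift => // z za; rewrite -expRD ler_expR addrC -za.
  exact: infconv_le.
have := tau_one_dim (mu_ge0 k) (mu_sum1 k) phi_c h_le (@v_diam k) kappa_l.
have -> : \sum_s mu k s * expR (h (v k s)) =
    \sum_s mu k s * expect ks (fun z => expR (infconv k QF z)) (upd y k (v k s)).
  by apply: eq_bigr => s _; rewrite lnK ?posrE.
apply: le_trans; rewrite -/QF; apply: ler_wpM2l.
  by apply: sumr_ge0 => s _; rewrite mulr_ge0// ltW.
apply: ler_sum => s _; apply: ler_wpM2l => //.
(* The induction hypothesis with coordinate [k] frozen says that the partial expectation of
   [exp (- F)] is at most [exp (- phi)]. *)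
by rewrite expRN lnK ?posrE// -[_^-1]mul1r ler_pdivlMr// mulrC; exact: IH.
Qed.

(* The last hypothesis is the AM-GM form, for all [a], of being Lipschitz with
   constant [sqrt sigma] in the Euclidean distance over [ks]. *)
Lemma convex_concentration ks F y sigma lam : uniq ks -> 0 < kappa ->
  (forall z, 0 <= F z) -> convexf F -> 0 <= lam ->
  (forall z z' a, 0 < a ->
     F z <= F z' + a * \sum_(j <- ks) (z j - z' j) ^+ 2 + sigma / (4 * a)) ->
  expect ks (fun z => expR (lam * (F z - expect ks F y))) y <=
  expR (lam ^+ 2 * sigma / (4 * kappa)).
Proof.
move=> uks k0 F0 cF lam0 FL.
have [lam00|lamn0] := eqVneq lam 0.
  rewrite lam00 expr0n/= !mul0r.
  by under eq_expect do rewrite mul0r; rewrite expect_cst.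
have lamp : 0 < lam by rewrite lt_neqAle eq_sym lamn0.
set m := expect ks F y.
pose G z := lam * F z.
have G0 z : 0 <= G z by rewrite mulr_ge0.
have cG : convexf G.
  move=> a b t t0 t1; rewrite /G.
  rewrite [leRHS](_ : _ = lam * ((1 - t) * F a + t * F b)); last by ring.
  by apply: ler_wpM2l => //; exact: cF.
have T := tau_product y uks G0 cG.
(* Jensen for the second factor of (tau) is what centres the concentration at the mean. *)
have E1 : expR (- (lam * m)) <= expect ks (fun z => expR (- G z)) y.
  apply: le_trans (expR_expect_le _ _ _); rewrite ler_expR.
  rewrite (_ : (fun z => - G z) = (fun z => - lam * F z)); last first.
    by apply/funext => z; rewrite /G mulNr.
  by rewrite expectZ mulNr.
have E2 : expR (- (lam ^+ 2 * sigma / (4 * kappa))) * expect ks (fun z => expR (G z)) y <=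
    expect ks (fun z => expR (infconvs ks G z)) y.
  rewrite -expectZ; apply: expect_le => z _; rewrite -expRD ler_expR.
  apply: le_infconvs => // z' _; rewrite -subr_ge0.
  (* With [a = kappa / lam], multiplying by [lam] makes the quadratic term equal to the transport
     cost and leaves the error [lam^2 sigma / (4 kappa)]. *)
  have := FL z z' (kappa / lam) (divr_gt0 k0 lamp).
  rewrite -(ler_pM2l lamp) -subr_ge0 => /le_trans; apply; rewrite /G.
  rewrite le_eqVlt; apply/orP; left; apply/eqP; field.
  by rewrite lamn0 gt_eqF.
have -> : (fun z => expR (lam * (F z - m))) = (fun z => expR (- (lam * m)) * expR (G z)).
  by apply/funext => z; rewrite -expRD /G; congr expR; ring.
rewrite expectZ -(ler_pM2l (expR_gt0 (- (lam ^+ 2 * sigma / (4 * kappa))))).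
rewrite -[leRHS]expRD addNr expR0; apply: le_trans T; rewrite mulrCA mulrC.
apply: ler_pM => //.
by rewrite mulr_ge0 ?expR_ge0// expect_ge0// => z; exact: expR_ge0.
Qed.

End ProductExpectation.

(** * Moments of linear forms *)

Section EvenMoments.
Variable R : realType.

Lemma even_pow_jensen (J : finType) (w z : J -> R) (l : nat) :
  (forall s, 0 <= w s) -> \sum_s w s = 1 ->
  (\sum_s w s * z s) ^+ l.*2 <= \sum_s w s * z s ^+ l.*2.
Proof.
move=> w0 w1; case: l => [|l].
  by rewrite expr0; under eq_bigr do rewrite expr0 mulr1; rewrite w1.
have ev x : x ^+ l.+1.*2 = `|x| ^+ l.+1.*2 :> R.
  by rewrite -normrX ger0_norm// -mul2n exprM exprn_ge0// sqr_ge0.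
set n := l.+1.*2; have n0 : (n%:R : R) != 0 by rewrite pnatr_eq0.
have n1 : (n%:R : R)^-1 <= 1 by rewrite invf_le1 ?ltr0n// ler1n.
have n2 : 0 <= (n%:R : R)^-1 by rewrite invr_ge0.
pose A := \sum_s w s * `|z s|; pose B := \sum_s w s * `|z s| ^+ n.
have B0 : 0 <= B by apply: sumr_ge0 => s _; rewrite mulr_ge0// exprn_ge0.
have A0 : 0 <= A by apply: sumr_ge0 => s _; rewrite mulr_ge0.
have : A <= B `^ n%:R^-1.
  apply: le_trans (powR_jensen w0 w1 (fun s => exprn_ge0 n (normr_ge0 (z s))) n2 n1).
  by apply: ler_sum => s _; rewrite -powR_mulrn// -powRrM divff// powRr1.
move=> AB; have -> : \sum_s w s * z s ^+ n = B by apply: eq_bigr => s _; rewrite ev.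
have -> : B = (B `^ n%:R^-1) ^+ n by rewrite -powR_mulrn ?powR_ge0// -powRrM mulVf// powRr1.
rewrite ev; apply: lerXn2r; rewrite ?nnegrE ?powR_ge0//.
apply: le_trans AB; apply: le_trans (ler_norm_sum _ _ _) _.
by apply: ler_sum => s _; rewrite normrM ger0_norm.
Qed.

(** Subtract an independent copy, which by Jensen only increases the even moment since the mean is
    zero. Then [x + p s - p s'] is the midpoint of [x + 2 p s] and [x - 2 p s'], and convexity
    decouples the two copies. The result involves no odd moments, at the price of a factor [2] on
    the variable. *)
Lemma even_pow_symmetrize (S : finType) (w p : S -> R) (x : R) (l : nat) :
  (forall s, 0 <= w s) -> \sum_s w s = 1 -> \sum_s w s * p s = 0 ->
  \sum_s w s * (x + p s) ^+ l.*2 <=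
  \sum_s w s * (2^-1 * ((x + 2 * p s) ^+ l.*2 + (x - 2 * p s) ^+ l.*2)).
Proof.
move=> w0 w1 wp.
have mid (a b : R) : (2^-1 * a + 2^-1 * b) ^+ l.*2 <= 2^-1 * a ^+ l.*2 + 2^-1 * b ^+ l.*2.
  have := @even_pow_jensen bool (fun=> 2^-1) (fun c => if c then a else b) l.
  by rewrite !big_bool/=; apply; [move=> _; lra|lra].
apply: (@le_trans _ _ (\sum_s w s * \sum_s' w s' *
    (2^-1 * (x + 2 * p s) ^+ l.*2 + 2^-1 * (x - 2 * p s') ^+ l.*2))).
  apply: ler_sum => s _; apply: ler_wpM2l => //.
  have -> : x + p s = \sum_s' w s' * (2^-1 * (x + 2 * p s) + 2^-1 * (x - 2 * p s')).
    rewrite (eq_bigr (fun s' => w s' * (x + p s) - w s' * p s')); last first.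
      by move=> s' _; field.
    by rewrite sumrB wp subr0 -mulr_suml w1 mul1r.
  apply: le_trans (even_pow_jensen _ _ w0 w1) _.
  by apply: ler_sum => s' _; apply: ler_wpM2l.
rewrite le_eqVlt; apply/orP; left; apply/eqP.
under eq_bigr do (under eq_bigr do rewrite mulrDr).
under eq_bigr do rewrite big_split/= -mulr_suml w1 mul1r mulrDr.
rewrite big_split/= -mulr_suml w1 mul1r -big_split/=.
by apply: eq_bigr => s _; ring.
Qed.

Lemma sum_even (f : nat -> R) (l : nat) : (forall i, odd i -> f i = 0) ->
  \sum_(i < l.*2.+1) f i = \sum_(a < l.+1) f a.*2.
Proof.
move=> f0; elim: l => [|l IH]; first by rewrite !big_ord_recr !big_ord0.
rewrite doubleS big_ord_recr big_ord_recr/= IH [RHS]big_ord_recr/=.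
by rewrite (f0 l.*2.+1) ?addr0//= odd_double.
Qed.

Lemma half_sum_pow (x u : R) (l : nat) :
  2^-1 * ((x + u) ^+ l.*2 + (x - u) ^+ l.*2) =
  \sum_(a < l.+1) 'C(l.*2, a.*2)%:R * x ^+ (l - a).*2 * u ^+ a.*2.
Proof.
rewrite !exprDn -big_split/= mulr_sumr.
pose f i := 2^-1 * (x ^+ (l.*2 - i) * u ^+ i *+ 'C(l.*2, i) +
   x ^+ (l.*2 - i) * (- u) ^+ i *+ 'C(l.*2, i)).
have f0 i : odd i -> f i = 0.
  move=> io; rewrite /f (exprNn u) -signr_odd io expr1.
  by rewrite mulN1r mulrN mulNrn subrr mulr0.
rewrite (eq_bigr (fun i : 'I_l.*2.+1 => f i)) => [|i _ //].
rewrite (sum_even l f0).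
apply: eq_bigr => a _.
rewrite /f -doubleB (exprNn u) -signr_odd odd_double expr0 mul1r -mulr_natl.
by field.
Qed.

End EvenMoments.

Section LinearFormMoments.
Variables (R : realType) (I : choiceType) (S : finType).
Variables (mu v : I -> S -> R).
Hypothesis mu_ge0 : forall k s, 0 <= mu k s.
Hypothesis mu_sum1 : forall k, \sum_s mu k s = 1.
Hypothesis v_mean0 : forall k, \sum_s mu k s * v k s = 0.

(* Up to geometric factors this is [((2a)!) ^ (beta + 1/2)]; the factor
   [(2a)! / a!] makes it exactly stable under binomial convolution. *)
Definition moment_bound (beta : R) (a : nat) : R :=
  ((a.*2)`!%:R `^ beta) * ((a.*2)`!%:R / a`!%:R).

Variables (beta D : R).
Hypothesis beta_ge0 : 0 <= beta.
Hypothesis D_ge0 : 0 <= D.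
Hypothesis v_moment : forall k a,
  \sum_s mu k s * v k s ^+ a.*2 <= moment_bound beta a * D ^+ a.

Lemma moment_bound_ge0 a : 0 <= moment_bound beta a.
Proof. by rewrite !mulr_ge0 ?powR_ge0 ?invr_ge0. Qed.

(** The factors [(2a)! / a!] give an equality. The powers [beta] only need
    [(2a)! (2l - 2a)! <= (2l)!] and [beta >= 0]. *)
Lemma moment_bound_mul (l a : nat) : (a <= l)%N ->
  'C(l.*2, a.*2)%:R * (moment_bound beta a * moment_bound beta (l - a)) <=
  moment_bound beta l * 'C(l, a)%:R.
Proof.
move=> al; rewrite /moment_bound.
have n0 (k : nat) : (k`!%:R : R) != 0 by rewrite pnatr_eq0 -lt0n fact_gt0.
have e2 : (l.*2`!%:R : R) = 'C(l.*2, a.*2)%:R * (a.*2`!%:R * (l - a).*2`!%:R).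
  by rewrite -!natrM doubleB bin_fact// leq_double.
have e1 : (l`!%:R : R) = 'C(l, a)%:R * (a`!%:R * (l - a)`!%:R).
  by rewrite -!natrM bin_fact.
have c0 : ('C(l, a)%:R : R) != 0 by rewrite pnatr_eq0 -lt0n bin_gt0.
rewrite -[leRHS]mulrA.
have -> : l.*2`!%:R / l`!%:R * 'C(l, a)%:R = 'C(l.*2, a.*2)%:R *
    ((a.*2`!%:R / a`!%:R) * ((l - a).*2`!%:R / (l - a)`!%:R)) :> R.
  by rewrite e2 e1; field; rewrite c0 !n0.
apply: (@le_trans _ _ ('C(l.*2, a.*2)%:R *
    (a.*2`!%:R / a`!%:R * ((l - a).*2`!%:R / (l - a)`!%:R)) *
    ((a.*2)`!%:R * ((l - a).*2)`!%:R) `^ beta)); last first.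
  rewrite [leRHS]mulrC; apply: ler_wpM2l.
    by rewrite mulr_ge0// mulr_ge0// divr_ge0.
  apply: ge0_ler_powR => //; rewrite ?nnegrE ?mulr_ge0// e2 ler_peMl ?mulr_ge0//.
  by rewrite ler1n bin_gt0 leq_double.
by rewrite powRM// le_eqVlt; apply/orP; left; apply/eqP; ring.
Qed.

(** Coordinate [k] is symmetrised and the power expanded; [moment_bound_mul] then converts the
    coefficients [C(2l, 2a)] into [C(l, a)], and the sum closes up as the binomial expansion of
    [(4 D (T + c_k^2))^l]. The [4] is the square of the factor lost in symmetrisation. *)
Lemma linear_form_moment ks (c : I -> R) (l : nat) y : uniq ks ->
  expect mu v ks (fun z => (\sum_(j <- ks) c j * z j) ^+ l.*2) y <=
  moment_bound beta l * (4 * D * \sum_(j <- ks) c j ^+ 2) ^+ l.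
Proof.
elim: ks l y => [|k ks IH] l y /=.
  rewrite !big_nil mulr0 => _; case: l => [|l]; last by rewrite !expr0n mulr0.
  by rewrite !expr0 mulr1 /moment_bound fact0 divr1 powR1 mulr1.
move=> /andP[kks uks].
pose Sg z := \sum_(j <- ks) c j * z j.
pose T := \sum_(j <- ks) c j ^+ 2.
have T0 : 0 <= T by apply: sumr_ge0 => j _; exact: sqr_ge0.
have SgE z b : Sg (upd z k b) = Sg z.
  rewrite /Sg big_seq [RHS]big_seq; apply: eq_bigr => j jks.
  by rewrite /upd; case: eqP kks => // <-; rewrite jks.
pose m a := \sum_s mu k s * v k s ^+ a.*2.
have m0 a : 0 <= m a.
  by apply: sumr_ge0 => s _; rewrite mulr_ge0// -mul2n exprM exprn_ge0// sqr_ge0.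
(* The integration over [k] is moved innermost, where the rest [Sg] of the form acts as a
   constant. *)
apply: (@le_trans _ _
    (expect mu v ks (fun z => \sum_s mu k s * (Sg z + c k * v k s) ^+ l.*2) y)).
  rewrite expect_sum; apply: ler_sum => s _; rewrite expectZ; apply: ler_wpM2l => //.
  rewrite -[leRHS]mul1r -[in leRHS](upd_id y k); apply: expect_shift => // z zk.
  by rewrite mul1r big_cons zk SgE addrC.
apply: (@le_trans _ _ (expect mu v ks (fun z => \sum_(a < l.+1)
    ('C(l.*2, a.*2)%:R * (4 * c k ^+ 2) ^+ a * m a) * Sg z ^+ (l - a).*2) y)).
  apply: expect_le => // z _.
  have cv0 : \sum_s mu k s * (c k * v k s) = 0.
    by under eq_bigr do rewrite mulrCA; rewrite -mulr_sumr v_mean0 mulr0.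
  apply: (le_trans (even_pow_symmetrize _ _ (mu_ge0 k) (mu_sum1 k) cv0)).
  under eq_bigr do rewrite half_sum_pow mulr_sumr.
  rewrite exchange_big/= le_eqVlt; apply/orP; left; apply/eqP.
  apply: eq_bigr => a _; rewrite /m mulr_sumr mulr_suml; apply: eq_bigr => s _.
  have -> : (2 * (c k * v k s)) ^+ a.*2 = (4 * c k ^+ 2) ^+ a * v k s ^+ a.*2.
    by rewrite -mul2n exprM [in RHS]exprM -exprMn; congr (_ ^+ _); ring.
  ring.
rewrite expect_sum big_cons.
have -> : 4 * D * (c k ^+ 2 + T) = 4 * D * T + 4 * D * c k ^+ 2 by ring.
rewrite exprDn mulr_sumr; apply: ler_sum => -[a /=]; rewrite ltnS => al _.
rewrite expectZ.
apply: (@le_trans _ _ ('C(l.*2, a.*2)%:R * (4 * c k ^+ 2) ^+ a *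
   (moment_bound beta a * D ^+ a) *
   (moment_bound beta (l - a) * (4 * D * T) ^+ (l - a)))).
  have p0 : 0 <= 'C(l.*2, a.*2)%:R * (4 * c k ^+ 2) ^+ a.
    by rewrite mulr_ge0// exprn_ge0// mulr_ge0// sqr_ge0.
  apply: ler_pM; [exact: mulr_ge0| |by apply: ler_wpM2l; last exact: v_moment|exact: IH].
  by apply: expect_ge0 => // z; rewrite -mul2n exprM exprn_ge0// sqr_ge0.
rewrite -[X in _ <= _ * X]mulr_natl [leRHS]mulrA.
rewrite [leLHS](_ : _ = 'C(l.*2, a.*2)%:R * (moment_bound beta a * moment_bound beta (l - a)) *
  ((4 * D * T) ^+ (l - a) * ((4 * c k ^+ 2) ^+ a * D ^+ a))); last by ring.
rewrite -exprMn (_ : 4 * c k ^+ 2 * D = 4 * D * c k ^+ 2); last by ring.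
apply: ler_wpM2r; last exact: moment_bound_mul.
by apply: mulr_ge0; apply: exprn_ge0; rewrite mulr_ge0 ?sqr_ge0// mulr_ge0.
Qed.

End LinearFormMoments.

(** * Duality of the norms *)

Section FiniteNorms.
Variable R : realType.
Implicit Types (p q s : R).

Lemma powR_le1 (a t : R) : 0 <= a -> a <= 1 -> 0 <= t -> a `^ t <= 1.
Proof.
move=> a0 a1 t0; have := ge0_ler_powR t0 _ _ a1; rewrite !nnegrE => /(_ a0 ler01).
by rewrite powR1.
Qed.

Lemma lnorm_ge0 n (s : \bar R) (x : 'I_n -> R) : 0 <= lnorm s x.
Proof.
by case: s => [s| |] /=; rewrite ?powR_ge0//; elim/big_ind: _ => // a b a0 b0;
  rewrite le_max a0.
Qed.

Lemma lnorm_powR n s (x : 'I_n -> R) : 0 < s ->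
  lnorm s%:E x `^ s = \sum_(j < n) `|x j| `^ s.
Proof.
move=> s0; rewrite /= -powRrM mulVf ?gt_eqF// powRr1// sumr_ge0//.
Qed.

Lemma lnorm_le n s (x : 'I_n -> R) b : 0 < s -> 0 <= b ->
  \sum_(j < n) `|x j| `^ s <= b `^ s -> lnorm s%:E x <= b.
Proof.
move=> s0 b0 h; rewrite /= -[leRHS]powRr1// -(divff (lt0r_neq0 s0)).
rewrite powRrM; apply: ge0_ler_powR => //.
- by rewrite invr_ge0 ltW.
- by rewrite nnegrE sumr_ge0.
- by rewrite nnegrE powR_ge0.
Qed.

Lemma le_lnorm n (s : \bar R) (x : 'I_n -> R) j : (0 < s)%E -> `|x j| <= lnorm s x.
Proof.
case: s => [s| |] //=; last by move=> _; apply: (@le_bigmax _ _ _ _ (fun j => `|x j|)).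
rewrite lte_fin => s0.
rewrite -[leLHS]powRr1// -(divff (lt0r_neq0 s0)) powRrM.
apply: ge0_ler_powR; rewrite ?nnegrE ?powR_ge0 ?sumr_ge0//.
  by rewrite invr_ge0 ltW.
by rewrite (bigD1 j)//= lerDl sumr_ge0.
Qed.

Lemma lnormZ n s (x : 'I_n -> R) c : 0 < s ->
  lnorm s%:E (fun j => c * x j) = `|c| * lnorm s%:E x.
Proof.
move=> s0; rewrite /=; under eq_bigr do rewrite normrM powRM//.
rewrite -mulr_sumr powRM ?powR_ge0//; last by apply: sumr_ge0 => j _; exact: powR_ge0.
by rewrite -powRrM divff ?gt_eqF// powRr1.
Qed.

Lemma lnorm0 n s : 0 < s -> lnorm s%:E (fun _ : 'I_n => 0 : R) = 0.
Proof.
move=> s0; rewrite /= big1 ?powR0 ?invr_eq0 ?gt_eqF// => j _.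
by rewrite normr0 powR0// gt_eqF.
Qed.

Lemma hconj_gt1 p : p != 1 -> hconj p = (p / (p - 1))%:E.
Proof. by rewrite /hconj => /negbTE ->. Qed.

Lemma ehalf_hconj_gt0 p : 1 <= p -> (0 < ehalf (hconj p))%E.
Proof.
move=> p1; rewrite /ehalf /hconj; case: eqP => [_|/eqP pn1].
  by rewrite gt0_mulye.
rewrite lte_fin mulr_gt0// divr_gt0//; first by lra.
by rewrite subr_gt0 lt_neqAle eq_sym pn1.
Qed.

(** The unit ball of the dual of [l_q], written through the squares [w^2] so that membership is
    literally the premise of the bound on the transposed squared matrix. *)
Definition dual_ball n q (w : 'I_n -> R) : Prop :=
  lnorm (ehalf (hconj q)) (fun i => w i ^+ 2) <= 1.

Lemma dual_ball1 n (w : 'I_n -> R) : dual_ball 1 w <-> forall i, `|w i| <= 1.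
Proof.
rewrite /dual_ball /hconj eqxx /ehalf gt0_mulye//=.
have e i : (`|w i ^+ 2| <= 1) = (`|w i| <= 1).
  by rewrite normrX -{1}(expr1n R 2) ler_pXn2r ?nnegrE.
split => [H i|H].
  rewrite -e; apply: le_trans H.
  exact: (@le_bigmax _ _ _ _ (fun j => `|w j ^+ 2|)).
by apply: bigmax_le => // i _; rewrite e.
Qed.

Lemma dual_ball_gt1 n q (w : 'I_n -> R) : 1 < q ->
  dual_ball q w <-> \sum_i `|w i| `^ (q / (q - 1)) <= 1.
Proof.
move=> q1; rewrite /dual_ball hconj_gt1 ?gt_eqF//.
have c0 : 0 < q / (q - 1) by rewrite divr_gt0; lra.
set c := q / (q - 1) in c0 *.
have E : \sum_i `|w i ^+ 2| `^ (c * 2^-1) = \sum_i `|w i| `^ c.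
  apply: eq_bigr => i _; rewrite normrX -powR_mulrn// -powRrM.
  by congr (_ `^ _); field.
have c2 : 0 < c * 2^-1 by lra.
split.
  rewrite -E -(@lnorm_powR n (c * 2^-1) (fun i => w i ^+ 2))// => h.
  by apply: powR_le1; rewrite ?lnorm_ge0// ltW.
by move=> h; apply: lnorm_le => //; rewrite E powR1.
Qed.

Lemma dual_le_lnorm n q (u w : 'I_n -> R) : 1 <= q -> dual_ball q w ->
  \sum_i u i * w i <= lnorm q%:E u.
Proof.
move=> q1; have [->|qn1] := eqVneq q 1.
  move=> /dual_ball1 H; rewrite /= invr1 powRr1 ?sumr_ge0//.
  apply: ler_sum => i _; rewrite powRr1//; apply: le_trans (ler_norm _) _.
  by rewrite normrM ler_piMr.
have q1' : 1 < q by rewrite lt_neqAle eq_sym qn1.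
move=> /(dual_ball_gt1 _ q1') H.
have q0 : q != 0 by rewrite gt_eqF//; lra.
have t0 : 0 <= q^-1 by rewrite invr_ge0; lra.
have t1 : q^-1 <= 1 by rewrite invf_le1; lra.
have q10 : q - 1 != 0 by rewrite subr_eq0.
apply: (@le_trans _ _ (\sum_i `|u i| * `|w i|)).
  by apply: ler_sum => i _; rewrite -normrM ler_norm.
have := @holder_sum R _ xpredT (fun i => `|u i| `^ q) (fun i => `|w i| `^ (q / (q - 1)))
  q^-1 (fun i => powR_ge0 _ _) (fun i => powR_ge0 _ _) t0 t1.
rewrite (eq_bigr (fun i => `|u i| * `|w i|)); last first.
  move=> i _; rewrite -!powRrM divff// powRr1//.
  by rewrite (_ : q / (q - 1) * (1 - q^-1) = 1) ?powRr1//; field; rewrite q0 q10.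
move=> /le_trans; apply; rewrite /= ler_piMr ?powR_ge0//.
by apply: powR_le1; rewrite ?subr_ge0 ?sumr_ge0.
Qed.

(** The witness is the equality case of Hölder, [sg u * (|u| / N)^(q - 1)]. Having an actual dual
    vector reduces statements about the norm to statements about one linear form. *)
Lemma dual_attained n q (u : 'I_n -> R) : 1 <= q ->
  exists2 w, dual_ball q w & lnorm q%:E u = \sum_i u i * w i.
Proof.
move=> q1; have [->|qn1] := eqVneq q 1.
  exists (fun i => Num.sg (u i)).
    by apply/dual_ball1 => i; rewrite normr_sg; case: (u i != 0).
  rewrite /= invr1 powRr1 ?sumr_ge0//.
  by apply: eq_bigr => i _; rewrite powRr1// mulrC -normrEsg.
have q1' : 1 < q by rewrite lt_neqAle eq_sym qn1.
have q0 : 0 < q by lra.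
have qd : q != 0 by rewrite gt_eqF.
have q10 : q - 1 != 0 by rewrite subr_eq0.
set N := lnorm q%:E u.
have N0 : 0 <= N by exact: lnorm_ge0.
have [N00|Nn0] := eqVneq N 0.
  exists (fun=> 0).
    apply/(dual_ball_gt1 _ q1'); rewrite big1// => i _; rewrite normr0 powR0//.
    by rewrite mulf_neq0// invr_eq0.
  by rewrite N00 big1// => i _; rewrite mulr0.
have Np : 0 < N by rewrite lt_neqAle eq_sym Nn0.
have NV c : N^-1 `^ c = (N `^ c)^-1 by rewrite -powR_inv1// -powRrM mulN1r powRN.
have NE : N `^ q = \sum_i `|u i| `^ q by exact: lnorm_powR.
exists (fun i => Num.sg (u i) * (`|u i| / N) `^ (q - 1)).
  apply/(dual_ball_gt1 _ q1').
  apply: (@le_trans _ _ (\sum_i (`|u i| `^ q / N `^ q))).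
    apply: ler_sum => i _; rewrite normrM normr_sg.
    have [->|un0] := eqVneq (u i) 0.
      rewrite mul0r powR0 ?divr_ge0 ?powR_ge0//.
      by rewrite mulf_neq0// invr_eq0.
    rewrite mul1r ger0_norm ?powR_ge0// -powRrM (_ : (q - 1) * _ = q); last by field.
    by rewrite powRM ?invr_ge0// NV.
  by rewrite -mulr_suml -NE divff// gt_eqF// powR_gt0.
rewrite (eq_bigr (fun i => `|u i| `^ q / N `^ (q - 1))); last first.
  move=> i _; rewrite mulrA [_ * Num.sg _]mulrC -normrEsg.
  by rewrite powRM ?invr_ge0// mulrA mulr_powRB1// NV.
by rewrite -mulr_suml -NE -mulr_powRB1// mulfK// gt_eqF// powR_gt0.
Qed.

Lemma lnormD n q (u v : 'I_n -> R) : 1 <= q ->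
  lnorm q%:E (fun i => u i + v i) <= lnorm q%:E u + lnorm q%:E v.
Proof.
move=> q1; have [w wb ->] := dual_attained (fun i => u i + v i) q1.
under eq_bigr do rewrite mulrDl.
by rewrite big_split/=; apply: lerD; exact: dual_le_lnorm.
Qed.

(** Hölder against the indicator of [P]. Half the conjugate of [p] is at least [1] because [p <= 2],
    and its reciprocal is [t = 2 - 2/p]. This is the origin of the factor [k^(2/p - 1)] in the
    variance of a sign vector. *)
Lemma sum_le_lnorm_hconj n p (P : pred 'I_n) (z : 'I_n -> R) :
  1 <= p -> p <= 2 -> (forall j, 0 <= z j) ->
  \sum_(j | P j) z j <= (#|P|%:R : R) `^ (2 / p - 1) * lnorm (ehalf (hconj p)) z.
Proof.
move=> p1 p2 z0; have [->|pn1] := eqVneq p 1.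
  rewrite divr1 (_ : 2 - 1 = 1) ?powRr1//; last by lra.
  rewrite -sum1_card natr_sum mulr_suml; apply: ler_sum => j _; rewrite mul1r.
  by rewrite -[leLHS]ger0_norm//; apply: le_lnorm; rewrite ehalf_hconj_gt0.
have p1' : 1 < p by rewrite lt_neqAle eq_sym pn1.
rewrite hconj_gt1//=.
have p0 : p != 0 by rewrite gt_eqF//; lra.
have p10 : p - 1 != 0 by rewrite subr_eq0.
pose t := 2 - 2 / p.
have te : (p / (p - 1) * 2^-1)^-1 = t by rewrite /t; field; rewrite p0 p10.
have pi : p^-1 < 1 by rewrite invf_lt1; lra.
have pi2 : 2^-1 <= p^-1 by rewrite lef_pV2 ?posrE; lra.
have t0 : 0 < t by rewrite /t; lra.
have t1 : t <= 1 by rewrite /t; lra.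
have te' : p / (p - 1) * 2^-1 = t^-1 by rewrite -te invrK.
rewrite te' invrK.
have := @holder_sum R _ P (fun i => z i `^ t^-1) (fun=> 1)
  t (fun i => powR_ge0 _ _) (fun i => ler01) (ltW t0) t1.
rewrite [X in X <= _ -> _](eq_bigr z); last first.
  by move=> i _ /=; rewrite powR1 mulr1 -powRrM mulVf ?gt_eqF// powRr1.
rewrite sumr_const -/(1%:R) => /le_trans; apply; rewrite mulrC.
rewrite (_ : 1 - t = 2 / p - 1); last by rewrite /t; ring.
apply: ler_wpM2l; first exact: powR_ge0.
apply: ge0_ler_powR; rewrite ?nnegrE ?sumr_ge0 ?(ltW t0)//.
  by move=> i _; exact: powR_ge0.
rewrite [leRHS](bigID P)/=.
rewrite [X in X + _](eq_bigr (fun i => z i `^ t^-1)) => [|i _]; last by rewrite ger0_norm.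
by rewrite lerDl sumr_ge0.
Qed.

End FiniteNorms.

(** * Sign vectors *)

Section SignVectors.
Variables (R : realType) (n : nat).

(* [{ffun 'I_n -> option bool}] encodes the vectors with entries in {0, 1, -1}. *)
Definition tern (o : option bool) : R :=
  if o is Some b then (if b then 1 else -1) else 0.

Definition tsupp (f : {ffun 'I_n -> option bool}) : nat := #|[pred j | isSome (f j)]|.

Lemma powR_le_self (x t : R) : 0 <= x -> x <= 1 -> t <= 1 -> x <= x `^ t.
Proof.
move=> x0 x1 t1; have [->|xn0] := eqVneq x 0; first exact: powR_ge0.
rewrite -[leLHS](powRr1 x0) -{1}[1 in leLHS](subrK t) powRD ?xn0 ?implybT//.
by rewrite ler_piMl ?powR_ge0// powR_le1// subr_ge0.
Qed.

(** With [x = k/(k+1)] one has [1 - x^t <= 1 - x = 1/(k+1)]; multiply by [(k+1)^t]. *)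
Lemma powR_increment (k : nat) (t : R) : 0 <= t -> t <= 1 ->
  k.+1%:R `^ t - k%:R `^ t <= (k.+1%:R^-1) `^ (1 - t).
Proof.
move=> t0 t1; have k0 : (k.+1%:R : R) != 0 by rewrite pnatr_eq0.
have k1 : (0 : R) <= k%:R / k.+1%:R by rewrite divr_ge0.
have k2 : k%:R / k.+1%:R <= (1 : R) by rewrite ler_pdivrMr ?ltr0n// mul1r ler_nat.
have -> : k%:R `^ t = (k%:R / k.+1%:R) `^ t * k.+1%:R `^ t :> R.
  by rewrite -powRM// divfK.
rewrite -{1}[k.+1%:R `^ t]mul1r -mulrBl.
apply: (@le_trans _ _ (k.+1%:R^-1 * k.+1%:R `^ t)).
  apply: ler_wpM2r; first exact: powR_ge0.
  rewrite lerBlDr -lerBlDl; apply: le_trans (powR_le_self k1 k2 t1).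
  rewrite le_eqVlt; apply/orP; left; apply/eqP.
  by rewrite -natr1; move: k0; rewrite -natr1; move=> k0; field.
have NV : k.+1%:R^-1 `^ t = (k.+1%:R `^ t)^-1 :> R.
  by rewrite -powR_inv1// -powRrM mulN1r powRN.
by rewrite powRB ?invr_eq0 ?k0 ?implybT// NV invrK powRr1// invr_ge0.
Qed.

Variables (p B : R) (N : ('I_n -> R) -> R).
Hypothesis p_ge1 : 1 <= p.
Hypothesis B_ge0 : 0 <= B.
Hypothesis N_add : forall x y, N (fun j => x j + y j) <= N x + N y.
Hypothesis N_scale : forall c x, N (fun j => c * x j) = `|c| * N x.
Hypothesis N_sign : forall f, (0 < tsupp f)%N ->
  N (fun j => tern (f j)) <= B * (tsupp f)%:R `^ p^-1.

(* Peeling off the smallest coordinate writes [x] as a positive combination of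
   sign vectors; the weights [w] are the increments of [k `^ p^-1], dominated by
   [k^-1 `^ (1 - p^-1)]. *)
Lemma exponent_gt0 : 0 < p.
Proof. exact: lt_le_trans ltr01 p_ge1. Qed.

Lemma sign_vectors_peel (e : 'I_n -> bool) (k : nat) (J : {set 'I_n}) (a : 'I_n -> R) :
  #|J| = k -> (forall j, 0 <= a j) -> (forall j, j \notin J -> a j = 0) ->
  exists w u : 'I_n -> R, [/\ \sum_(j in J) w j = k%:R `^ p^-1,
    \sum_(j in J) u j = \sum_(i < k) i.+1%:R^-1,
    forall j, 0 <= u j, forall j, j \in J -> w j <= u j `^ (1 - p^-1) &
    N (fun j => tern (Some (e j)) * a j) <= B * \sum_(j in J) w j * a j].
Proof.
have pi0 : 0 <= p^-1 by rewrite invr_ge0 ltW// exponent_gt0.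
have pin0 : p^-1 != 0 by rewrite invr_eq0 gt_eqF// exponent_gt0.
have pi1 : p^-1 <= 1 by rewrite invf_le1 ?exponent_gt0.
elim: k J a => [|k IH] J a cJ a0 aJ.
  move/eqP: cJ; rewrite cards_eq0 => /eqP J0.
  exists (fun=> 0), (fun=> 0); split => //; rewrite ?J0 ?big_set0 ?big_ord0 ?powR0//.
  rewrite mulr0 (_ : (fun j => _) = (fun j => 0 * 0)).
    by rewrite N_scale normr0 mul0r.
  by apply/funext => j; rewrite aJ ?J0 ?inE// mulr0 mul0r.
have [j1 j1J] : exists j, j \in J by apply/set0Pn; rewrite -card_gt0 cJ.
have [j0 j0J jmin] : exists2 j0, j0 \in J & forall j, j \in J -> a j0 <= a j.
  by case: (@Order.TotalTheory.arg_minP _ R _ j1 (mem J) a j1J) => j0; exists j0.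
set t := a j0 in jmin.
pose a' j := if j \in J then a j - t else 0.
have a'0 j : 0 <= a' j by rewrite /a'; case: ifP => // jJ; rewrite subr_ge0 jmin.
have a'J j : j \notin (J :\ j0)%SET -> a' j = 0.
  rewrite !inE negb_and negbK => /orP[/eqP ->|/negbTE jJ]; rewrite /a' ?jJ//.
  by rewrite j0J subrr.
have cJ' : #|(J :\ j0)%SET| = k by move: cJ; rewrite (cardsD1 j0) j0J => -[].
have [w [u [sw su u0 wu Nw]]] := IH _ _ cJ' a'0 a'J.
(* The smallest of the [k+1] coordinates receives the last increment, so that Abel summation turns
   layer heights times [k^(1/p)] into the sum of [w j * a j]. The companion [u] records the inverse
   rank. *)
pose w1 j := if j == j0 then k.+1%:R `^ p^-1 - k%:R `^ p^-1 else w j.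
pose u1 j := if j == j0 then k.+1%:R^-1 else u j.
have split_sum (g : 'I_n -> R) : \sum_(j in J) g j = g j0 + \sum_(j in (J :\ j0)%SET) g j.
  by rewrite (big_setD1 j0).
have w1E (g : 'I_n -> R) :
    \sum_(j in (J :\ j0)%SET) w1 j * g j = \sum_(j in (J :\ j0)%SET) w j * g j.
  by apply: eq_bigr => j; rewrite !inE => /andP[/negbTE jj _]; rewrite /w1 jj.
have w1E' : \sum_(j in (J :\ j0)%SET) w1 j = k%:R `^ p^-1.
  by rewrite -sw; apply: eq_bigr => j; rewrite !inE => /andP[/negbTE jj _]; rewrite /w1 jj.
exists w1, u1; split.
- by rewrite split_sum w1E' {1}/w1 eqxx subrK.
- rewrite split_sum big_ord_recr/= [RHS]addrC; congr (_ + _); first by rewrite /u1 eqxx.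
  by rewrite -su; apply: eq_bigr => j; rewrite !inE => /andP[/negbTE jj _]; rewrite /u1 jj.
- by move=> j; rewrite /u1; case: ifP => // _; rewrite invr_ge0.
- move=> j jJ; rewrite /w1 /u1; case: ifPn => [_|jj]; first exact: powR_increment.
  by apply: wu; rewrite !inE jj.
(* The peeled layer: all of [J] with the prescribed signs, at height [t]. *)
pose f := [ffun j => if j \in J then Some (e j) else None].
have sf : tsupp f = k.+1.
  rewrite -cJ; apply: eq_card => j; rewrite !inE ffunE.
  by case: (j \in J).
have -> : (fun j => tern (Some (e j)) * a j) =
    (fun j => tern (Some (e j)) * a' j + t * tern (f j)).
  apply/funext => j; rewrite ffunE /a'; case: ifPn => jJ.
    by rewrite mulrBr [t * _]mulrC subrK.
  by rewrite aJ// !mulr0 addr0.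
apply: le_trans (N_add _ _) _; rewrite N_scale ger0_norm; last exact: a0.
have Nf := N_sign (f := f); rewrite sf in Nf.
have {Nf} := ler_wpM2l (a0 j0) (Nf isT); rewrite -/t => Nf.
apply: (le_trans (lerD Nw Nf)).
rewrite split_sum w1E {1}/w1 eqxx -/t.
have -> : \sum_(j in (J :\ j0)%SET) w j * a' j =
   \sum_(j in (J :\ j0)%SET) w j * a j - t * k%:R `^ p^-1.
  rewrite -sw mulr_sumr -sumrB; apply: eq_bigr => j; rewrite !inE => /andP[_ jJ].
  by rewrite /a' jJ; ring.
by rewrite le_eqVlt; apply/orP; left; apply/eqP; ring.
Qed.

(** The sum of [w j * |x j|] is a Lorentz [l_{p,1}] norm. Hölder compares it with the [l_p] norm,
    and since the [u j] add up to the harmonic sum, the loss is that sum to the power [1 - 1/p]. *)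
Lemma norm_le_sign_vectors (x : 'I_n -> R) : lnorm p%:E x <= 1 ->
  N x <= B * (\sum_(i < n) i.+1%:R^-1) `^ (1 - p^-1).
Proof.
move=> x1; have pi0 : 0 <= p^-1 by rewrite invr_ge0 ltW// exponent_gt0.
have pi1 : p^-1 <= 1 by rewrite invf_le1 ?exponent_gt0.
have p0 : p != 0 by rewrite gt_eqF// exponent_gt0.
have cT : #|[set: 'I_n]%SET| = n by rewrite cardsT card_ord.
have xT j : j \notin [set: 'I_n]%SET -> `|x j| = 0 by rewrite inE.
have [w [u [_ su u0 wu]]] := sign_vectors_peel (fun j => 0 <= x j) cT
  (fun j => normr_ge0 (x j)) xT.
rewrite (_ : (fun j => _ * _) = x); last first.
  apply/funext => j /=; case: ifPn => xj; first by rewrite mul1r ger0_norm.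
  by rewrite mulN1r ltr0_norm ?opprK// ltNge.
move=> /le_trans; apply; apply: ler_wpM2l => //.
apply: (@le_trans _ _ (\sum_(j in [set: 'I_n]%SET) (`|x j| `^ p) `^ p^-1 * u j `^ (1 - p^-1))).
  apply: ler_sum => j jT; rewrite -powRrM divff// powRr1// mulrC.
  by apply: ler_wpM2l => //; exact: wu.
apply: le_trans (holder_sum _ _ _ pi0 pi1) _ => //.
rewrite su ler_piMl ?powR_ge0//.
rewrite (_ : \sum_(j in _) _ = \sum_(j < n) `|x j| `^ p)//.
by apply: eq_bigl => j; rewrite inE.
Qed.

End SignVectors.

Section SignVectorSums.
Variables (R : realType) (n : nat).

(** The generating function of the supports factors over coordinates, each contributing [1 + x + x].
    At [x = 1/n] it evaluates the union bound over all sign vectors. *)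
Lemma sum_tsupp (x : R) :
  \sum_(f : {ffun 'I_n -> option bool}) x ^+ tsupp f = (1 + 2 * x) ^+ n.
Proof.
pose g (o : option bool) := if isSome o then x else 1.
have -> : (1 + 2 * x) ^+ n = \prod_(j < n) \sum_o g o.
  rewrite prodr_const card_ord; congr (_ ^+ _).
  rewrite (bigD1 None)//= (bigD1 (Some true))//= (bigD1 (Some false))//=.
  rewrite big_pred0 => [|[[]|]//]; rewrite /g/=; ring.
rewrite bigA_distr_bigA/=; apply: eq_bigr => f _.
by rewrite /g -big_mkcond/= prodr_const.
Qed.

Lemma sum_tern_powR (f : {ffun 'I_n -> option bool}) (s : R) : s != 0 ->
  \sum_j `|tern R (f j)| `^ s = (tsupp f)%:R.
Proof.
move=> s0; rewrite /tsupp -sum1_card natr_sum [RHS]big_mkcond/=.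
apply: eq_bigr => j _; rewrite inE; case: (f j) => [[]|]/=.
- by rewrite normr1 powR1.
- by rewrite normrN normr1 powR1.
- by rewrite normr0 powR0.
Qed.

Lemma tern_sqr (o : option bool) : tern R o ^+ 2 = (isSome o)%:R.
Proof. by case: o => [[]|] /=; rewrite ?sqrrN ?expr1n ?expr0n. Qed.

End SignVectorSums.

(** * Size of the moment bound *)

Section FactorialBounds.
Variable R : realType.

Lemma fact_add_le (a b : nat) : ((a + b)`! <= a`! * (a + b) ^ b)%N.
Proof.
elim: b => [|b IH]; first by rewrite addn0 expn0 muln1.
rewrite addnS factS expnS mulnCA leq_mul//.
apply: (leq_trans IH); rewrite leq_mul//.
by case: b {IH} => // b; rewrite leq_exp2r.
Qed.

(** From [(2l)! <= (2l)^(2l)] and [(2l)! / l! <= (2l)^l]. At [beta = 1/r - 1/2] the exponent is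
    [1/r], the power of [q] in the theorem. *)
Lemma moment_bound_root (beta : R) (l : nat) : 0 <= beta -> (0 < l)%N ->
  moment_bound beta l `^ (l.*2%:R)^-1 <= l.*2%:R `^ (beta + 2^-1).
Proof.
move=> b0 l0.
have l20 : (l.*2%:R : R) != 0 by rewrite pnatr_eq0 -lt0n double_gt0.
have h : moment_bound beta l <= (l.*2%:R `^ (beta + 2^-1)) ^+ l.*2.
  rewrite -powR_mulrn ?powR_ge0// -powRrM mulrDl powRD ?l20 ?implybT//.
  apply: ler_pM; rewrite ?powR_ge0 ?divr_ge0//.
    rewrite mulrC powRrM powR_mulrn//; apply: le_powR2r => //.
    rewrite -natrX ler_nat; have := @fact_add_le 0 l.*2.
    by rewrite add0n fact0 mul1n.
  have -> : 2^-1 * l.*2%:R = l%:R :> R by rewrite -muln2 natrM mulrCA mulVf ?mulr1.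
  rewrite powR_mulrn// ler_pdivrMr ?ltr0n ?fact_gt0// -natrX -natrM ler_nat mulnC.
  by have := fact_add_le l l; rewrite addnn.
have i0 : 0 <= (l.*2%:R : R)^-1 by rewrite invr_ge0.
apply: (le_trans (le_powR2r i0 (moment_bound_ge0 _ _) h)).
by rewrite -powR_mulrn ?powR_ge0// -!powRrM divff// mulr1.
Qed.

End FactorialBounds.

(** * Entries with finitely many values *)

Section FiniteTheorem.
Variables (R : realType) (m n : nat) (A : 'M[R]_(m, n)) (p q S1 S2 : R).
Hypothesis p_ge1 : 1 <= p.
Hypothesis p_le2 : p <= 2.
Hypothesis q_ge1 : 1 <= q.
Hypothesis S1_ge0 : 0 <= S1.
Hypothesis S2_gt0 : 0 < S2.
Hypothesis A_S1 : forall x, lnorm (p / 2)%:E x <= 1 ->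
  lnorm (q / 2)%:E (mxapp (hsq A) x) <= S1.
Hypothesis A_S2 : forall x, lnorm (ehalf (hconj q)) x <= 1 ->
  lnorm (ehalf (hconj p)) (mxapp (hsq A)^T x) <= S2.

Lemma sum_entries (F : 'I_m * 'I_n -> R) : \sum_k F k = \sum_i \sum_j F (i, j).
Proof. by rewrite pair_bigA; apply: eq_bigr => -[i j]. Qed.

(* [bilin y x] is [Y_A x], the entries of [Y] being those of [y]. *)
Definition bilin (y : 'I_m * 'I_n -> R) (x : 'I_n -> R) : 'I_m -> R :=
  fun i => \sum_j A i j * y (i, j) * x j.

Lemma bilin_convex x : convexf (fun y => lnorm q%:E (bilin y x)).
Proof.
have q0 : 0 < q by exact: lt_le_trans q_ge1.
move=> y z t t0 t1; rewrite -[X in X * _ + _]ger0_norm ?subr_ge0//.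
rewrite -[X in _ + X * _]ger0_norm// -!lnormZ//.
apply: le_trans (lnormD _ _ q_ge1).
rewrite le_eqVlt; apply/orP; left; apply/eqP; congr lnorm; apply/funext => i.
by rewrite /bilin !mulr_sumr -big_split/=; apply: eq_bigr => j _; ring.
Qed.

(** The left-hand side is the squared Euclidean norm of the functional obtained by testing
    [bilin y x] against [w]. Summing over rows first gives the entries of the transposed squared
    matrix applied to [w^2], restricted to the support of the sign vector. *)
Lemma weak_variance (f : {ffun 'I_n -> option bool}) w : dual_ball q w ->
  \sum_(k : 'I_m * 'I_n) (A k.1 k.2 * tern R (f k.2) * w k.1) ^+ 2 <=
  (tsupp f)%:R `^ (2 / p - 1) * S2.
Proof.
move=> /A_S2 H.
pose z := mxapp (hsq A)^T (fun i => w i ^+ 2).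
have z0 j : 0 <= z j.
  by apply: sumr_ge0 => i _; rewrite !mxE mulr_ge0// sqr_ge0.
apply: (@le_trans _ _ (\sum_(j | isSome (f j)) z j)).
  rewrite sum_entries/=.
  rewrite exchange_big/= [leRHS]big_mkcond/=; apply: ler_sum => j _.
  rewrite /z /mxapp; under eq_bigr do rewrite !exprMn tern_sqr.
  case: (isSome _) => /=; last by rewrite big1// => i _; rewrite mulr0 mul0r.
  by apply: ler_sum => i _; rewrite !mxE mulr1.
apply: (le_trans (sum_le_lnorm_hconj _ p_ge1 p_le2 z0)).
by apply: ler_wpM2l H; exact: powR_ge0.
Qed.

(** After the triangle inequality, test the difference against a norming [w] and use
    [b c <= a b^2 + c^2 / (4 a)] entrywise. The squares of the [c] add up to the weak variance. *)
Lemma bilin_lipschitz (f : {ffun 'I_n -> option bool}) (y z : 'I_m * 'I_n -> R) (a : R) : 0 < a ->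
  lnorm q%:E (bilin y (fun j => tern R (f j))) <=
    lnorm q%:E (bilin z (fun j => tern R (f j))) +
    a * \sum_(k <- enum {: 'I_m * 'I_n}) (y k - z k) ^+ 2 +
    ((tsupp f)%:R `^ (2 / p - 1) * S2) / (4 * a).
Proof.
move=> a0; set x := fun j => _; set D := \sum_(k <- _) _.
have -> : D = \sum_k (y k - z k) ^+ 2 by rewrite /D big_enum.
rewrite [X in lnorm _ X <= _](_ : _ = (fun i => bilin z x i + bilin (fun k => y k - z k) x i));
  last by apply/funext => i; rewrite /bilin -big_split/=; apply: eq_bigr => j _; ring.
apply: le_trans (lnormD _ _ q_ge1) _; rewrite -addrA lerD2l.
have [w wb ->] := dual_attained (bilin (fun k => y k - z k) x) q_ge1.
have a4 : 0 < 4 * a by rewrite mulr_gt0.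
have V : (\sum_(k : 'I_m * 'I_n) (A k.1 k.2 * x k.2 * w k.1) ^+ 2) / (4 * a) <=
    ((tsupp f)%:R `^ (2 / p - 1) * S2) / (4 * a).
  by rewrite ler_pdivrMr// divfK ?gt_eqF// weak_variance.
apply: le_trans (lerD (lexx _) V).
rewrite mulr_sumr mulr_suml -big_split/=.
rewrite (_ : \sum_i _ = \sum_(k : 'I_m * 'I_n) (y k - z k) * (A k.1 k.2 * x k.2 * w k.1)).
  apply: ler_sum => k _; set b := y k - z k; set c := _ * w k.1.
  rewrite -subr_ge0 (_ : _ - _ = (2 * a * b - c) ^+ 2 / (4 * a)).
    by rewrite divr_ge0 ?sqr_ge0// ltW.
  by field; rewrite gt_eqF.
rewrite sum_entries/=.
by apply: eq_bigr => i _; rewrite /bilin mulr_suml; apply: eq_bigr => j _; ring.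
Qed.

Variables (S : finType) (mu v : 'I_m * 'I_n -> S -> R) (beta D M : R).
Hypothesis mu_ge0 : forall k s, 0 <= mu k s.
Hypothesis mu_sum1 : forall k, \sum_s mu k s = 1.
Hypothesis v_mean0 : forall k, \sum_s mu k s * v k s = 0.
Hypothesis beta_ge0 : 0 <= beta.
Hypothesis D_ge0 : 0 <= D.
Hypothesis v_moment : forall k a,
  \sum_s mu k s * v k s ^+ a.*2 <= moment_bound beta a * D ^+ a.
Hypothesis M_gt0 : 0 < M.
Hypothesis v_diam : forall k s s', (v k s - v k s') ^+ 2 <= (2 * M) ^+ 2.
Hypothesis n_ge2 : (2 <= n)%N.

Let ks := enum {: 'I_m * 'I_n}.
Let E := expect mu v ks.

Definition mean_bound : R := (3 * q) `^ (beta + 2^-1) * (4 * D) `^ 2^-1 * S1 `^ 2^-1.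

(** Jensen moves the expectation inside the powers [1/q] and then [q/(2l)], which reduces each row
    to an even moment. The row variances [s] are the squared matrix applied to [x^2], so their
    [l_{q/2}] norm is controlled by [S1]. *)
Lemma bilin_mean (f : {ffun 'I_n -> option bool}) y : (0 < tsupp f)%N ->
  E (fun z => lnorm q%:E (bilin z (fun j => tern R (f j)))) y <=
  mean_bound * (tsupp f)%:R `^ p^-1.
Proof.
move=> f0; have q0 : 0 < q by exact: lt_le_trans q_ge1.
have p0 : 0 < p by exact: lt_le_trans p_ge1.
have K0 : 0 < (tsupp f)%:R :> R by rewrite ltr0n.
set K := (tsupp f)%:R : R.
(* [2l] is the least even integer above [q]; it is at most [q + 2 <= 3 q]. *)
pose l := (Num.truncn (q / 2)).+1.
have [l1 l2] : q <= l.*2%:R /\ l.*2%:R <= 3 * q.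
  have /truncn_itv/andP[h1 h2] : 0 <= q / 2 by rewrite divr_ge0// ltW.
  rewrite -muln2 natrM; split; first by rewrite -ler_pdivrMr// ltW.
  have e : (l%:R : R) = (Num.truncn (q / 2))%:R + 1 by rewrite natr1.
  by have q1 := q_ge1; rewrite e; lra.
have l0 : (0 < l)%N by [].
have l20 : 0 < (l.*2%:R : R) by rewrite ltr0n double_gt0.
pose x j := tern R (f j).
pose s i := \sum_j (A i j * x j) ^+ 2.
have s0 i : 0 <= s i by apply: sumr_ge0 => j _; exact: sqr_ge0.
have sS : lnorm (q / 2)%:E s <= K `^ (2 / p) * S1.
  (* The rescaled vector [K^(-2/p) x^2] has [l_{p/2}] norm one. Only homogeneity is used, so
     exponents below one are harmless. *)
  have -> : s = (fun i => K `^ (2 / p) * mxapp (hsq A) (fun j => K `^ (- (2 / p)) * x j ^+ 2) i).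
    apply/funext => i; rewrite /s /mxapp mulr_sumr; apply: eq_bigr => j _.
    rewrite mxE exprMn powRN.
    by field; rewrite gt_eqF// powR_gt0.
  rewrite lnormZ ?divr_gt0// ger0_norm ?powR_ge0//.
  apply: ler_wpM2l; rewrite ?powR_ge0//; apply: A_S1.
  apply: lnorm_le => //; first by rewrite divr_gt0.
  rewrite powR1 (eq_bigr (fun j => K^-1 * `|tern R (f j)| `^ p)).
    by rewrite -mulr_sumr sum_tern_powR ?gt_eqF// mulVf// gt_eqF.
  move=> j _; rewrite normrM powRM// normrX ger0_norm ?powR_ge0// -powRrM.
  rewrite -powR_mulrn// -[in X in _ * X]powRrM (_ : - (2 / p) * (p / 2) = -1).
    by rewrite powR_inv1 ?ler0n//; congr (_ * _ `^ _); field.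
  by field; exact: lt0r_neq0.
have uks : uniq ks by exact: enum_uniq.
have mb0 := moment_bound_ge0 beta l.
have D40 : 0 <= 4 * D by rewrite mulr_ge0.
have Ei i : E (fun z => `|bilin z x i| `^ q) y <=
    (moment_bound beta l `^ (l.*2%:R)^-1 * (4 * D) `^ 2^-1) `^ q * (s i) `^ (q / 2).
  pose c (k : 'I_m * 'I_n) := if k.1 == i then A i k.2 * x k.2 else 0.
  have bE z : bilin z x i = \sum_(k <- ks) c k * z k.
    rewrite big_enum/= sum_entries.
    rewrite (bigD1 i)//= [X in _ + X]big1 ?addr0; last first.
      by move=> i' /negbTE ii; rewrite big1// => j _; rewrite /c ii mul0r.
    by apply: eq_bigr => j _; rewrite /c eqxx; ring.
  have cE : \sum_(k <- ks) c k ^+ 2 = s i.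
    rewrite big_enum/= sum_entries.
    rewrite (bigD1 i)//= [X in _ + X]big1 ?addr0; last first.
      by move=> i' /negbTE ii; rewrite big1// => j _; rewrite /c ii expr0n.
    by apply: eq_bigr => j _; rewrite /c eqxx.
  have := linear_form_moment mu_ge0 mu_sum1 v_mean0 beta_ge0 D_ge0 v_moment c l y uks.
  rewrite cE => H.
  have t0 : 0 <= q / l.*2%:R by rewrite divr_ge0 ?ltW.
  have t1 : q / l.*2%:R <= 1 by rewrite ler_pdivrMr// mul1r.
  have ev z : 0 <= z ^+ l.*2 :> R by rewrite -mul2n exprM exprn_ge0// sqr_ge0.
  have -> : (fun z => `|bilin z x i| `^ q) =
      (fun z => ((\sum_(k <- ks) c k * z k) ^+ l.*2) `^ (q / l.*2%:R)).
    apply/funext => z; rewrite -bE -[X in X `^ (q / _)]ger0_norm// normrX.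
    rewrite -powR_mulrn// -powRrM; congr (_ `^ _); field; by rewrite gt_eqF.
  apply: le_trans (expect_powR_le v mu_ge0 mu_sum1 ks y (fun z => ev _) t0 t1) _.
  have E0 : 0 <= expect mu v ks (fun z => (\sum_(k <- ks) c k * z k) ^+ l.*2) y.
    by apply: expect_ge0.
  apply: (le_trans (le_powR2r t0 E0 H)).
  rewrite (powRM _ mb0 (exprn_ge0 l (mulr_ge0 D40 (s0 i)))).
  rewrite (powRM _ (powR_ge0 _ _) (powR_ge0 _ _)) exprMn.
  rewrite (powRM _ (exprn_ge0 l D40) (exprn_ge0 l (s0 i))) -!powR_mulrn// -!powRrM.
  have -> : l%:R * (q / l.*2%:R) = q / 2 :> R.
    by rewrite -muln2 natrM; field; rewrite pnatr_eq0.
  rewrite mulrA le_eqVlt; apply/orP; left; apply/eqP.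
  by congr (_ `^ _ * _ `^ _ * _); rewrite mulrC.
set C := moment_bound beta l `^ _ * _ in Ei.
have C0 : 0 <= C by rewrite mulr_ge0 ?powR_ge0.
have qi0 : 0 <= q^-1 by rewrite invr_ge0 ltW.
have qi1 : q^-1 <= 1 by rewrite invf_le1.
have step1 : E (fun z => lnorm q%:E (bilin z x)) y <= C * (lnorm (q / 2)%:E s) `^ 2^-1.
  rewrite /=; apply: le_trans (expect_powR_le v mu_ge0 mu_sum1 ks y _ qi0 qi1) _.
    by move=> z; apply: sumr_ge0 => i _; exact: powR_ge0.
  rewrite expect_sum.
  have h := ler_sum (P := xpredT) (index_enum 'I_m) (fun i _ => Ei i).
  have h0 : 0 <= \sum_i E (fun z => `|bilin z x i| `^ q) y.
    by apply: sumr_ge0 => i _; apply: expect_ge0 => // z; exact: powR_ge0.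
  apply: (le_trans (le_powR2r qi0 h0 h)).
  rewrite -mulr_sumr powRM ?powR_ge0//; last by apply: sumr_ge0 => i _; exact: powR_ge0.
  rewrite -(powRrM C) (divff (lt0r_neq0 q0)) (powRr1 C0) -(powRrM _ (q / 2)^-1).
  apply: ler_wpM2l; first exact: C0.
  rewrite (eq_bigr (fun i => `|s i| `^ (q / 2))) => [|i _]; last by rewrite ger0_norm.
  rewrite (_ : (q / 2)^-1 * 2^-1 = q^-1)//.
  by field; rewrite gt_eqF.
apply: (le_trans step1).
have step2 : (lnorm (q / 2)%:E s) `^ 2^-1 <= K `^ p^-1 * S1 `^ 2^-1.
  have h2 : 0 <= (2^-1 : R) by [].
  apply: (le_trans (le_powR2r h2 (lnorm_ge0 _ _) sS)).
  rewrite powRM ?powR_ge0// -powRrM (_ : 2 / p * 2^-1 = p^-1)//.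
  by field; rewrite gt_eqF.
have step3 : C <= (3 * q) `^ (beta + 2^-1) * (4 * D) `^ 2^-1.
  apply: ler_wpM2r; first exact: powR_ge0.
  apply: (le_trans (moment_bound_root beta_ge0 l0)).
  by apply: le_powR2r => //; apply: addr_ge0.
have -> : mean_bound * K `^ p^-1 = (3 * q) `^ (beta + 2^-1) * (4 * D) `^ 2^-1 *
    (K `^ p^-1 * S1 `^ 2^-1) by rewrite /mean_bound; ring.
exact: (ler_pM C0 (powR_ge0 _ _) step3 step2).
Qed.

Definition deviation_scale : R := ln n%:R `^ 2^-1 * M * S2 `^ 2^-1.

Lemma ln_n_gt0 : 0 < ln n%:R :> R.
Proof. by apply: lt_le_trans (ln_ge_half R n_ge2). Qed.

Lemma deviation_scale_gt0 : 0 < deviation_scale.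
Proof. by rewrite mulr_gt0 ?powR_gt0// mulr_gt0// powR_gt0// ln_n_gt0. Qed.

Definition sign_norm (f : {ffun 'I_n -> option bool}) z :=
  lnorm q%:E (bilin z (fun j => tern R (f j))).

(* Here [17 = 16 + 1]: concentration gives the exponent [16 k ln n], and one more
   [k ln n] pays for the union bound. *)
Lemma sign_vector_deviation f y : (0 < tsupp f)%N ->
  E (fun z => expR ((tsupp f)%:R * ln n%:R *
     ((sign_norm f z - E (sign_norm f) y) /
        (deviation_scale * (tsupp f)%:R `^ p^-1) - 17))) y <=
  (n%:R^-1) ^+ tsupp f.
Proof.
pose F := sign_norm f; move=> f0; rewrite -/F; have L0 := ln_n_gt0; have T0 := deviation_scale_gt0.
set L := ln n%:R in L0 *; set T := deviation_scale in T0 *.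
have K0 : 0 < (tsupp f)%:R :> R by rewrite ltr0n.
set K := (tsupp f)%:R : R.
set a := K `^ p^-1; have a0 : 0 < a by exact: powR_gt0.
pose lam := K * L / (T * a).
have lam0 : 0 <= lam by apply/ltW/divr_gt0; exact: mulr_gt0.
(* The largest value with [kappa * (2 * M)^2 <= 1/16]. *)
pose kappa := (64 * M ^+ 2)^-1.
have k0 : 0 < kappa by rewrite invr_gt0 mulr_gt0// exprn_gt0.
have kl : kappa * (2 * M) ^+ 2 <= 16^-1.
  rewrite le_eqVlt; apply/orP; left; apply/eqP; rewrite /kappa.
  by field; rewrite gt_eqF.
have uks : uniq ks by exact: enum_uniq.
have q0 : 0 < q by exact: lt_le_trans q_ge1.
have := convex_concentration mu_ge0 mu_sum1 (ltW k0) v_diam kl y uks k0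
  (F := F) (fun z => lnorm_ge0 _ _) (bilin_convex _) lam0
  (fun z z' b => @bilin_lipschitz f z z' b).
(* Since [K^(2/p - 1) = a^2 / K], the normalisation by [a] leaves the variance with a factor [1/K].
   This makes the exponent proportional to [K * L], the size of the union bound at support [K]. *)
have -> : lam ^+ 2 * (K `^ (2 / p - 1) * S2) / (4 * kappa) = 16 * (K * L).
  have -> : K `^ (2 / p - 1) = a ^+ 2 / K.
    rewrite powRB ?(gt_eqF K0) ?implybT// powRr1 ?ltW//; congr (_ / _).
    by rewrite -powR_mulrn ?powR_ge0// -powRrM mulrC.
  have TE : T ^+ 2 = L * M ^+ 2 * S2.
    have sq b : 0 <= b -> (b `^ 2^-1) ^+ 2 = b :> R.
      by move=> b0; rewrite -powR_mulrn ?powR_ge0// -powRrM mulVf ?pnatr_eq0// powRr1.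
    by rewrite /T /deviation_scale !exprMn !sq ?ltW.
  have Tn : T != 0 by rewrite gt_eqF.
  have -> : lam ^+ 2 = K ^+ 2 * L ^+ 2 / (L * M ^+ 2 * S2 * a ^+ 2).
    by rewrite -TE /lam; field; rewrite Tn gt_eqF.
  by rewrite /kappa; field; rewrite !gt_eqF.
move=> H.
rewrite (_ : (fun z => expR _) =
    (fun z => expR (- (17 * (K * L))) * expR (lam * (F z - E F y)))); last first.
  apply/funext => z; rewrite -expRD; congr expR; rewrite /lam.
  by field; rewrite !gt_eqF.
rewrite /E expectZ; apply: (le_trans (ler_wpM2l (expR_ge0 _) H)).
rewrite -expRD (_ : _ + _ = (tsupp f)%:R * (- L)); last by rewrite /K; ring.
by rewrite expRM_natl expRN lnK// posrE ltr0n; exact: ltn_trans n_ge2.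
Qed.

(** A majorant [Bf], uniform in [x], is produced instead of a bound on the expected supremum:
    composed with finitely valued entries it is measurable for free. The base point [y0] is
    arbitrary because every coordinate is integrated. *)
Lemma expect_opnorm_bound y0 : exists Bf : ('I_m * 'I_n -> R) -> R,
  (forall y x, lnorm p%:E x <= 1 -> lnorm q%:E (bilin y x) <= Bf y) /\
  E Bf y0 <= (3 * ln n%:R) `^ (1 - p^-1) * (mean_bound + 49 * deviation_scale).
Proof.
have L0 := ln_n_gt0; have T0 := deviation_scale_gt0.
have p0 : 0 < p by exact: lt_le_trans p_ge1.
have q0 : 0 < q by exact: lt_le_trans q_ge1.
have n0 : (0 < n)%N by exact: ltn_trans n_ge2.
have Lh : 2^-1 <= ln n%:R :> R by exact: ln_ge_half.
set L := ln n%:R in L0 Lh *; set T := deviation_scale in T0 *.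
have mb0 : 0 <= mean_bound by rewrite !mulr_ge0 ?powR_ge0.
(* A soft union bound: the sum of the positive terms [g f] dominates every normalised excess at
   once, by [x <= exp x]. *)
pose g f z := expR ((tsupp f)%:R * L *
  ((sign_norm f z - E (sign_norm f) y0) / (T * (tsupp f)%:R `^ p^-1) - 17)).
(* The coefficient [2] comes from [1 / (K * L) <= 2]. As the expected sum is at most [16], the total
   is [17 + 2 * 16 = 49]. *)
pose B z := mean_bound + 17 * T + 2 * T * \sum_(f | (0 < tsupp f)%N) g f z.
pose H := \sum_(i < n) i.+1%:R^-1 : R.
have H0 : 0 <= H by apply: sumr_ge0 => i _; rewrite invr_ge0.
have e0 : 0 <= 1 - p^-1 by rewrite subr_ge0 invf_le1.
have g0 z : 0 <= \sum_(f | (0 < tsupp f)%N) g f z.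
  by apply: sumr_ge0 => f _; exact: expR_ge0.
have T20 : 0 <= 2 * T by rewrite mulr_ge0// ltW.
have B0 z : 0 <= B z.
  apply: addr_ge0; last exact: mulr_ge0.
  by apply: addr_ge0 => //; apply: mulr_ge0 => //; exact: ltW.
exists (fun z => B z * H `^ (1 - p^-1)); split => [y x x1|].
  apply: (@norm_le_sign_vectors R n p (B y) (fun x => lnorm q%:E (bilin y x))) => //.
  - move=> a b; apply: le_trans (lnormD _ _ q_ge1).
    rewrite le_eqVlt; apply/orP; left; apply/eqP; congr lnorm; apply/funext => i.
    by rewrite /bilin -big_split/=; apply: eq_bigr => j _; ring.
  - move=> c a; rewrite -(lnormZ _ _ q0); congr lnorm; apply/funext => i.
    by rewrite /bilin mulr_sumr; apply: eq_bigr => j _; ring.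
  - move=> f f0; rewrite -/(sign_norm f y).
    have K1 : 1 <= (tsupp f)%:R :> R by rewrite ler1n.
    set K := (tsupp f)%:R : R in K1 *.
    have K0 : 0 < K by exact: lt_le_trans K1.
    have a0 : 0 < K `^ p^-1 by exact: powR_gt0.
    have mf : E (sign_norm f) y0 <= mean_bound * K `^ p^-1 by exact: bilin_mean.
    pose xi := K * L * ((sign_norm f y - E (sign_norm f) y0) / (T * K `^ p^-1) - 17).
    have -> : sign_norm f y = E (sign_norm f) y0 +
        T * K `^ p^-1 * (17 + xi / (K * L)).
      by rewrite /xi; field; rewrite !gt_eqF.
    have xg : xi / (K * L) <= 2 * \sum_(f | (0 < tsupp f)%N) g f y.
      apply: (@le_trans _ _ (2 * g f y)); last first.
        rewrite ler_wpM2l// (bigD1 f)//= lerDl; apply: sumr_ge0 => f' _.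
        exact: expR_ge0.
      rewrite ler_pdivrMr ?mulr_gt0//.
      have xe : xi <= g f y by apply: le_trans (expR_ge1Dx _); rewrite lerDr.
      apply: (le_trans xe); rewrite mulrAC ler_peMl ?expR_ge0//.
      have : 1 * 2^-1 <= K * L by apply: ler_pM.
      by lra.
    apply: (le_trans (lerD mf (lexx _))); rewrite /B.
    rewrite [leRHS](_ : _ = mean_bound * K `^ p^-1 +
      T * K `^ p^-1 * (17 + 2 * \sum_(f | (0 < tsupp f)%N) g f y)); last by ring.
    rewrite lerD2l; apply: ler_wpM2l; last by rewrite lerD2l.
    by apply: mulr_ge0; apply: ltW.
have -> : (fun z => B z * H `^ (1 - p^-1)) = (fun z => H `^ (1 - p^-1) * B z).
  by apply/funext => z; rewrite mulrC.
rewrite /E expectZ.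
have HL : H <= 3 * L.
  by apply: (le_trans (harmonic_le_ln R n0)); rewrite -/L; lra.
apply: ler_pM; rewrite ?powR_ge0 ?expect_ge0//; first exact: le_powR2r.
rewrite /B expectD expect_cst// expectZ expect_sum.
(* The total is at most [(1 + 2/n)^n <= e^2], and [e^2 <= 16] follows from [exp (1/2) <= 2]. *)
have sg : \sum_(f | (0 < tsupp f)%N) expect mu v ks (g f) y0 <= 16.
  apply: (@le_trans _ _ (\sum_(f : {ffun 'I_n -> option bool}) (n%:R^-1) ^+ tsupp f)).
    rewrite [leLHS]big_mkcond/=; apply: ler_sum => f _; case: ifPn => f0.
      exact: sign_vector_deviation.
    by rewrite exprn_ge0// invr_ge0.
  rewrite sum_tsupp.
  have h1 : 1 + 2 * n%:R^-1 <= expR (2 / n%:R) :> R by exact: expR_ge1Dx.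
  apply: (@le_trans _ _ (expR (2 / n%:R) ^+ n)).
    by apply: lerXn2r => //; rewrite ?nnegrE ?expR_ge0// addr_ge0// mulr_ge0// invr_ge0.
  rewrite -expRM_natl mulrCA divff ?pnatr_eq0 -?lt0n// mulr1.
  have -> : (2 : R) = 4%:R * 2^-1 by lra.
  rewrite expRM_natl; apply: (@le_trans _ _ (2 ^+ 4)).
    by apply: lerXn2r; rewrite ?nnegrE ?expR_ge0// expR_half_le2.
  by lra.
have := ler_wpM2l T20 sg; lra.
Qed.

End FiniteTheorem.

(** * Reduction to finitely many values *)

Section Resampling.
Variables (R : realType) (I S : finType) (mu v : I -> S -> R).
Hypothesis mu_sum1 : forall k, \sum_s mu k s = 1.

(** Exchanging the fresh value [s] with [g k] is an involution that preserves the product weight. *)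
Lemma sum_resample (k : I) (H : {ffun I -> S} -> R) :
  \sum_(g : {ffun I -> S}) (\prod_j mu j (g j)) * H g =
  \sum_s mu k s * \sum_(g : {ffun I -> S}) (\prod_j mu j (g j)) *
    H [ffun j => if j == k then s else g j].
Proof.
pose sw (u : S * {ffun I -> S}) : S * {ffun I -> S} :=
  (u.2 k, [ffun j => if j == k then u.1 else u.2 j]).
have swK : involutive sw.
  move=> [s g]; rewrite /sw /= ffunE eqxx; congr pair.
  by apply/ffunP => j; rewrite !ffunE; case: eqP => // ->.
under [RHS]eq_bigr do rewrite mulr_sumr.
rewrite [RHS]pair_bigA/= (reindex_inj (inv_inj swK))/=.
rewrite -(pair_bigA _ (fun s (g : {ffun I -> S}) => mu k (g k) *
  ((\prod_j mu j ([ffun j => if j == k then s else g j] j)) *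
   H [ffun j => if j == k then g k else [ffun j => if j == k then s else g j] j])))/=.
rewrite exchange_big/=; apply: eq_bigr => g _.
rewrite -[LHS]mul1r -(mu_sum1 k) mulr_suml; apply: eq_bigr => s _.
have -> : [ffun j => if j == k then g k else [ffun j => if j == k then s else g j] j] = g.
  by apply/ffunP => j; rewrite !ffunE; case: eqP => // ->.
rewrite (bigD1 k)//= [in RHS](bigD1 k)//= ffunE eqxx.
rewrite [in RHS](eq_bigr (fun j => mu j (g j))); first by ring.
by move=> j /negbTE jk; rewrite ffunE jk.
Qed.

Lemma expect_sum_ffun (ks : seq I) (F : (I -> R) -> R) y : uniq ks ->
  expect mu v ks F y = \sum_(g : {ffun I -> S}) (\prod_j mu j (g j)) *
    F (fun j => if j \in ks then v j (g j) else y j).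
Proof.
elim: ks y => [|k ks IH] y /=.
  move=> _; rewrite -mulr_suml -(bigA_distr_bigA (fun j s => mu j s)).
  by rewrite big1 ?mul1r// => j _; exact: mu_sum1.
move=> /andP[kks uks]; rewrite (sum_resample k); apply: eq_bigr => s _.
rewrite IH//; congr (_ * _); apply: eq_bigr => g _; congr (_ * F _).
apply/funext => j; rewrite inE ffunE /upd; case: eqP => [->|//].
by rewrite (negbTE kks).
Qed.

End Resampling.

(** * Truncation and rounding of one real number *)

Section Rounding.
Variables (R : realType) (M delta : R).
Hypothesis M_ge0 : 0 <= M.
Hypothesis delta_gt0 : 0 < delta.

Definition round_levels : nat := Num.truncn (M / delta).

(* Truncation at level [M] followed by rounding towards [0] on the grid
   [delta Z]; a cell stores the sign and the absolute level. *)
Definition round_cell (x : R) : bool * 'I_round_levels.+1 :=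
  if `|x| <= M then (x < 0, inord (Num.truncn (`|x| / delta))) else (false, ord0).

Definition cell_value (s : bool * 'I_round_levels.+1) : R :=
  (-1) ^+ s.1 * (delta * (s.2 : nat)%:R).

Lemma norm_cell_value s : `|cell_value s| = delta * (s.2 : nat)%:R.
Proof.
rewrite /cell_value normrM normrX normrN normr1 expr1n mul1r ger0_norm//.
by rewrite mulr_ge0// ltW.
Qed.

Lemma cell_value_le s : `|cell_value s| <= M.
Proof.
have h0 : 0 <= M / delta by rewrite divr_ge0// ltW.
have /andP[h _] := truncn_itv h0.
rewrite norm_cell_value mulrC -ler_pdivlMr//; apply: le_trans h.
by rewrite ler_nat -ltnS.
Qed.

(** Guarantees that [inord] in [round_cell] never falls back to its default value. *)
Lemma trunc_level_lt (x : R) : `|x| <= M -> (Num.truncn (`|x| / delta) < round_levels.+1)%N.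
Proof.
move=> xM; rewrite ltnS /round_levels.
by apply: le_truncn; rewrite ler_pM2r ?invr_gt0.
Qed.

Lemma norm_cell_value_round (x : R) : `|x| <= M ->
  `|cell_value (round_cell x)| = delta * (Num.truncn (`|x| / delta))%:R.
Proof. by move=> xM; rewrite norm_cell_value /round_cell xM/= inordK// trunc_level_lt. Qed.

Lemma trunc_itv (x : R) : delta * (Num.truncn (`|x| / delta))%:R <= `|x| <
  delta * (Num.truncn (`|x| / delta))%:R + delta.
Proof.
have h0 : 0 <= `|x| / delta by rewrite divr_ge0// ltW.
have /andP[h1 h2] := truncn_itv h0.
rewrite mulrC -ler_pdivlMr// h1/=.
by rewrite -{3}[delta]mul1r -mulrDl natr1 -ltr_pdivrMr.
Qed.

(** Holds because rounding goes towards [0]; it lets exponential moments pass to the rounded entries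
    unchanged. *)
Lemma round_le (x : R) : `|cell_value (round_cell x)| <= `|x|.
Proof.
have [xM|xM] := boolP (`|x| <= M); last first.
  by rewrite norm_cell_value /round_cell (negbTE xM)/= mulr0.
by rewrite norm_cell_value_round//; case/andP: (trunc_itv x).
Qed.

Lemma round_dist (x : R) : `|x| <= M -> `|x - cell_value (round_cell x)| <= delta.
Proof.
move=> xM; have := norm_cell_value_round xM; have /andP[h1 h2] := trunc_itv x.
move: h1 h2; rewrite norm_cell_value /cell_value => h1 h2 e.
move: h1 h2; rewrite -e; set t := delta * _ => h1 h2.
rewrite {1}/round_cell xM/=; have [x0|x0] := ltP x 0.
  rewrite expr1 mulN1r opprK (_ : x + t = - (`|x| - t)); last first.
    by rewrite ltr0_norm//; ring.
  by rewrite normrN ger0_norm ?subr_ge0// lerBlDl ltW.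
rewrite expr0 mul1r (_ : x - t = `|x| - t); last by rewrite (ger0_norm x0).
by rewrite ger0_norm ?subr_ge0// lerBlDl ltW.
Qed.

Lemma round_out (x : R) : M < `|x| -> cell_value (round_cell x) = 0.
Proof.
by move=> xM; rewrite /cell_value /round_cell leNgt xM/= expr0 mulr0 mul1r.
Qed.

Lemma measurable_round_cell s : measurable (round_cell @^-1` [set s]).
Proof.
case: s => b j.
pose f (x : R) := ((`|x| <= M) && ((if b then x < 0 else 0 <= x) &&
   (((j : nat)%:R <= `|x| / delta) && (`|x| / delta < j.+1%:R)))) ||
   ((M < `|x|) && ((b, j) == (false, ord0))).
have -> : round_cell @^-1` [set (b, j)] = f @^-1` [set true].
  apply/seteqP; split => x; rewrite /= /round_cell /f [M < _]ltNge.
    case: ifPn => xM; last by case=> <- <-; rewrite eqxx.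
    case=> <- <-; rewrite inordK ?trunc_level_lt//= orbF.
    have h0 : 0 <= `|x| / delta by rewrite divr_ge0// ltW.
    by rewrite truncn_itv// andbT; case: ltP.
  case: (boolP (`|x| <= M)) => xM /=; last by move=> /eqP ->.
  rewrite orbF => /andP[bx /truncn_def e].
  rewrite e inord_val; congr pair.
  by clear f; case: b bx => // /le_gtF.
suff mf : measurable_fun setT f.
  by have := mf measurableT [set true] I; rewrite setTI.
have mn : measurable_fun setT (fun x : R => `|x| : R) by exact: normr_measurable.
have md : measurable_fun setT (fun x : R => `|x| / delta : R).
  by apply: measurable_funM.
rewrite /f {f}; apply: measurable_or; apply: measurable_and => //.
- exact: measurable_fun_ler.
- apply: measurable_and.
    by case: b; [exact: measurable_fun_ltr|exact: measurable_fun_ler].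
  by apply: measurable_and; [exact: measurable_fun_ler|exact: measurable_fun_ltr].
- exact: measurable_fun_ltr.
Qed.

End Rounding.

(** * Integrals of functions with finitely many values *)

Section Integrals.
Context d (T : measurableType d) (R : realType) (P : probability T R).

(* No measurability is needed: the integral of a nonnegative function is a
   supremum over the simple functions below it. *)
Lemma ge0_integral_mono (f g : T -> \bar R) : (forall w, 0 <= f w)%E ->
  (forall w, f w <= g w)%E -> (\int[P]_w f w <= \int[P]_w g w)%E.
Proof.
move=> f0 fg; rewrite !ge0_integralTE//; last first.
  by move=> w; exact: le_trans (fg w).
apply: ereal_sup_le => _ [h hf <-]; exists h => //= w.
exact: le_trans (hf w) (fg w).
Qed.

Lemma finite_valued_indic (S : finType) (h : T -> S) (f : S -> R) w :
  (f (h w))%:E = \sum_(s <- index_enum S) ((f s)%:E * (\1_(h @^-1` [set s]) w)%:E)%E.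
Proof.
rewrite (bigD1_seq (h w)) ?mem_index_enum ?index_enum_uniq//=.
rewrite big1 ?adde0.
  by rewrite indicE mem_set//= mule1.
by move=> s sw; rewrite indicE memNset ?mule0// => /esym/eqP; rewrite (negbTE sw).
Qed.

Lemma measurable_finite_valued (S : finType) (h : T -> S) (f : S -> R) :
  (forall s, measurable (h @^-1` [set s])) ->
  measurable_fun setT (fun w => (f (h w))%:E).
Proof.
move=> mh; rewrite (funext (finite_valued_indic h f)).
apply: emeasurable_sum => s; apply: measurable_funeM.
by apply/measurable_EFinP; exact: measurable_indic.
Qed.

Lemma integral_finite_valued (S : finType) (h : T -> S) (f : S -> R) :
  (forall s, measurable (h @^-1` [set s])) -> (forall s, 0 <= f s) ->
  (\int[P]_w (f (h w))%:E)%E = (\sum_s fine (P (h @^-1` [set s])) * f s)%:E.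
Proof.
move=> mh f0.
have mi s : measurable_fun setT (fun w => (\1_(h @^-1` [set s]) w : R)%:E).
  by apply/measurable_EFinP; exact: measurable_indic.
rewrite (eq_integral _ _ (fun w _ => finite_valued_indic h f w)).
rewrite ge0_integral_sum//; last 2 first.
- by move=> s; exact: measurable_funeM.
- by move=> s w _; rewrite mule_ge0// lee_fin.
rewrite -sumEFin; apply: eq_bigr => s _.
rewrite ge0_integralZl_EFin//.
rewrite integral_indic// setIT EFinM fineK ?fin_num_measure//.
by rewrite muleC.
Qed.

Lemma sum_cell_probability (S : finType) (h : T -> S) :
  (forall s, measurable (h @^-1` [set s])) ->
  \sum_s fine (P (h @^-1` [set s])) = 1.
Proof.
move=> mh; have := integral_finite_valued mh (fun=> ler01).
have -> : (\int[P]_w (1 : R)%:E = 1)%E.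
  by rewrite integral_cst// mul1e; exact: probability_setT.
by case=> ->; apply: eq_bigr => s _; rewrite mulr1.
Qed.

Lemma integral_finite_valued_signed (S : finType) (h : T -> S) (f : S -> R) :
  (forall s, measurable (h @^-1` [set s])) ->
  (\int[P]_w (f (h w))%:E)%E = (\sum_s fine (P (h @^-1` [set s])) * f s)%:E.
Proof.
move=> mh; rewrite integralE.
rewrite (eq_integral (fun w => (Num.max (f (h w)) 0)%:E)); last first.
  by move=> w _; rewrite funeposE EFin_max.
rewrite [X in (_ - X)%E](eq_integral (fun w => (Num.max (- f (h w)) 0)%:E)); last first.
  by move=> w _; rewrite funenegE EFin_max.
rewrite (integral_finite_valued (f := fun s => Num.max (f s) 0) mh) => [|s]; last first.
  by rewrite le_max lexx orbT.
rewrite (integral_finite_valued (f := fun s => Num.max (- f s) 0) mh) => [|s]; last first.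
  by rewrite le_max lexx orbT.
rewrite -EFinB -sumrB; congr EFin; apply: eq_bigr => s _; rewrite -mulrBr; congr (_ * _).
case: (leP 0 (f s)) => h0.
  by rewrite (max_r (x := - f s)) ?oppr_le0// subr0.
by rewrite (max_l (x := - f s)) ?oppr_ge0 ?ltW// sub0r opprK.
Qed.

Lemma joint_cell_preimage (I S : finType) (X : I -> T -> R) (c : I -> R -> S)
    (g : {ffun I -> S}) :
  (fun w => [ffun k => c k (X k w)]) @^-1` [set g] =
  \bigcap_(k in [set: I]) (X k @^-1` (c k @^-1` [set g k])).
Proof.
apply/seteqP; split => w /=.
  by move=> hg k _ /=; rewrite -hg ffunE.
by move=> H; apply/ffunP => k; rewrite ffunE; exact: H.
Qed.

Lemma measurable_joint_cell (I S : finType) (X : I -> T -> R) (c : I -> R -> S)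
    (g : {ffun I -> S}) :
  (forall k, measurable_fun setT (X k)) ->
  (forall k s, measurable (c k @^-1` [set s])) ->
  measurable ((fun w => [ffun k => c k (X k w)]) @^-1` [set g]).
Proof.
move=> mX mc; rewrite joint_cell_preimage.
apply: fin_bigcap_measurable => // k _.
by rewrite -[X in measurable X]setTI; exact: mX.
Qed.

(** Independence enters here: the joint law of the cells is a product, so the integral is the
    iterated finite sum [expect]. *)
Lemma integral_independent (I S : finType) (X : I -> T -> R) (c : I -> R -> S)
  (v : I -> S -> R) (F : (I -> R) -> R) (y : I -> R) :
  (forall k, measurable_fun setT (X k)) ->
  (forall k s, measurable (c k @^-1` [set s])) ->
  mutually_independent P X -> (forall z, 0 <= F z) ->
  (\int[P]_w (F (fun k => v k (c k (X k w))))%:E)%E =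
  (expect (fun k s => fine (P (X k @^-1` (c k @^-1` [set s])))) v (enum I) F y)%:E.
Proof.
move=> mX mc indX F0.
pose h w := [ffun k => c k (X k w)].
have mXc k s : measurable (X k @^-1` (c k @^-1` [set s])).
  by rewrite -[X in measurable X]setTI; exact: mX.
have mh g : measurable (h @^-1` [set g]) by exact: measurable_joint_cell.
rewrite (eq_integral (fun w => (F (fun k => v k (h w k)))%:E)); last first.
  by move=> w _; congr (F _)%:E; apply/funext => k; rewrite ffunE.
rewrite (integral_finite_valued mh (fun g : {ffun I -> S} => F0 (fun k => v k (g k)))).
have mu1 k : \sum_s fine (P (X k @^-1` (c k @^-1` [set s]))) = 1.
  exact: (@sum_cell_probability S (fun w => c k (X k w)) (mXc k)).
rewrite (expect_sum_ffun v mu1 F y (enum_uniq I)); congr EFin.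
apply: eq_bigr => g _; congr (_ * F _); last first.
  by apply/funext => k; rewrite mem_enum.
rewrite joint_cell_preimage indX; last by move=> k; exact: mc.
rewrite (eq_bigr (fun k => (fine (P (X k @^-1` (c k @^-1` [set g k]))))%:E)).
  by rewrite prodEFin.
by move=> k _; rewrite fineK// fin_num_measure.
Qed.

End Integrals.

(** * Exponential moments from the tail condition *)

Section SubWeibull.
Context d (T : measurableType d) (R : realType) (P : probability T R).
Variables (r K L : R).
Hypothesis r_gt0 : 0 < r.
Hypothesis K_gt0 : 0 < K.
Hypothesis L_gt0 : 0 < L.

Definition exp_moment_bound : R := K * expR 2^-1 / (1 - expR (- 2^-1)).

Lemma exp_moment_bound_ge0 : 0 <= exp_moment_bound.
Proof.
by rewrite divr_ge0 ?mulr_ge0 ?expR_ge0 ?ltW// subr_gt0 expR_lt1; lra.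
Qed.

(** With [k] the integer part of [|X|^r / L], the integrand is at most [exp ((k + 1) / 2)] and the
    event [A k] occurs, so the series of the [f k] dominates. Since [A k] has probability at most
    [K exp (- k)], integration leaves a geometric series of ratio [exp (- 1/2)], whose sum is
    [exp_moment_bound]. Taking half the tail rate makes it converge. *)
Lemma exp_moment_le (X : T -> R) : measurable_fun setT X ->
  (forall t, 0 <= t -> (P [set w | (t <= `|X w|)%R] <= (K * expR (- (t `^ r / L)))%:E)%E) ->
  (\int[P]_w (expR (`|X w| `^ r / (2 * L)))%:E <= exp_moment_bound%:E)%E.
Proof.
move=> mX tail.
pose A (k : nat) := [set w | ((L * k%:R) `^ r^-1 <= `|X w|)%R].
have mA k : measurable (A k).
  have := @measurable_fun_ler _ _ _ setT (fun=> (L * k%:R) `^ r^-1) (fun w => `|X w|)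
    (measurable_cst _) (measurableT_comp (@normr_measurable R setT) mX) measurableT
    [set true] I.
  by rewrite setTI.
have PA k : (P (A k) <= (K * expR (- k%:R))%:E)%E.
  apply: (le_trans (tail _ (powR_ge0 _ _))); rewrite lee_fin.
  rewrite -powRrM mulVf ?gt_eqF// powRr1 ?mulr_ge0 ?(ltW L_gt0)//.
  have -> : L * k%:R / L = k%:R by field; exact: lt0r_neq0.
  exact: lexx.
pose f (k : nat) (w : T) : \bar R := ((expR (k.+1%:R / 2))%:E * (\1_(A k) w)%:E)%E.
have f0 k w : (0 <= f k w)%E by rewrite mule_ge0// lee_fin ?expR_ge0.
have mf k : measurable_fun setT (f k).
  by apply: measurable_funeM; apply/measurable_EFinP; exact: measurable_indic.
have le1 w : ((expR (`|X w| `^ r / (2 * L)))%:E <= \sum_(0 <= k <oo) f k w)%E.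
  pose u := `|X w| `^ r / L.
  have u0 : 0 <= u by rewrite divr_ge0 ?powR_ge0 ?ltW.
  have /andP[u1 u2] := truncn_itv u0.
  set k := Num.truncn u in u1 u2.
  have Ak : A k w.
    rewrite /A/= [leRHS](_ : _ = (`|X w| `^ r) `^ r^-1); last first.
      by rewrite -powRrM divff ?lt0r_neq0// powRr1.
    have i0 : 0 <= r^-1 by rewrite invr_ge0 ltW.
    have Lk0 : 0 <= L * k%:R by rewrite mulr_ge0// ltW.
    apply: (le_powR2r i0 Lk0); move: u1.
    by rewrite /u ler_pdivlMr// [k%:R * L]mulrC.
  apply: le_trans (nneseries_lim_ge k.+1 (fun n _ _ => f0 n w)).
  rewrite big_nat_recr//=; apply: (@le_trans _ _ (f k w)).
    rewrite /f indicE mem_set// mule1 lee_fin ler_expR.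
    rewrite [leLHS](_ : _ = u / 2); last by rewrite /u; field; rewrite gt_eqF.
    by rewrite ler_pM2r// ltW.
  by rewrite leeDr// sume_ge0.
apply: (le_trans (ge0_integral_mono P _ le1)) => [w|]; first by rewrite lee_fin expR_ge0.
rewrite integral_nneseries//.
apply: lime_le.
  by apply: is_cvg_nneseries => k _ _; apply: integral_ge0 => w _; exact: f0.
apply: nearW => N.
have z1 : expR (- 2^-1) < 1 :> R by rewrite expR_lt1; lra.
pose z := expR (- 2^-1) : R.
apply: (@le_trans _ _ (\sum_(0 <= k < N) (K * expR 2^-1 * z ^+ k))%:E).
  rewrite -sumEFin; apply: lee_sum => k _.
  rewrite ge0_integralZl_EFin ?expR_ge0//; last first.
    by apply/measurable_EFinP; exact: measurable_indic.
  rewrite integral_indic// setIT.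
  apply: (@le_trans _ _ ((expR (k.+1%:R / 2))%:E * (K * expR (- k%:R))%:E)%E).
    by apply: lee_wpmul2l; [rewrite lee_fin expR_ge0|exact: PA].
  rewrite -EFinM lee_fin /z -expRM_natl mulrCA -!mulrA -!expRD.
  rewrite le_eqVlt; apply/orP; left; apply/eqP; congr (_ * expR _).
  by rewrite -natr1; field.
rewrite lee_fin -mulr_sumr /exp_moment_bound -/z ler_wpM2l ?mulr_ge0 ?expR_ge0 ?(ltW K_gt0)//.
have zn : 1 - z != 0 by rewrite gt_eqF// subr_gt0.
rewrite -[leRHS]mul1r ler_pdivlMr ?subr_gt0//.
rewrite mulrC big_mkord -opprB mulNr -subrX1 opprB.
by rewrite gerBl exprn_ge0// expR_ge0.
Qed.

(* From [u ^ N / N! <= e ^ u] with [u] a multiple of [x ^ r], then a root. *)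
Lemma pow_le_fact_expR (c x : R) (N : nat) : 0 < c -> 0 <= x ->
  x ^+ N <= (c / r) `^ (N%:R / r) * N`!%:R `^ r^-1 * expR (x `^ r / c).
Proof.
move=> c0 x0; case: N => [|N].
  rewrite expr0 mul0r powRr0 fact0 powR1 !mul1r -expR0 ler_expR.
  by rewrite divr_ge0 ?powR_ge0// ltW.
pose u := r * (x `^ r / c).
have xc0 : 0 <= x `^ r / c by rewrite divr_ge0 ?powR_ge0// ltW.
have u0 : 0 <= u by rewrite mulr_ge0// ltW.
have i0 : 0 <= r^-1 by rewrite invr_ge0 ltW.
have h : u ^+ N.+1 <= N.+1`!%:R * expR u.
  rewrite mulrC -ler_pdivrMr ?ltr0n ?fact_gt0//.
  by apply: le_trans (expR_ge1Dxn N u0); rewrite lerDr.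
have hr := le_powR2r i0 (exprn_ge0 _ u0) h.
have cr0 : 0 < c / r by exact: divr_gt0.
have -> : x ^+ N.+1 = (c / r) `^ (N.+1%:R / r) * (u ^+ N.+1) `^ r^-1.
  rewrite -powR_mulrn// -powR_mulrn// -[in RHS]powRrM -powRM ?(ltW cr0)//.
  have -> : c / r * u = x `^ r by rewrite /u; field; rewrite !gt_eqF.
  by rewrite -powRrM; congr (_ `^ _); field; rewrite gt_eqF.
rewrite -mulrA; apply: ler_wpM2l; first exact: powR_ge0.
apply: (le_trans hr); rewrite powRM ?expR_ge0//; apply: ler_wpM2l; first exact: powR_ge0.
rewrite -expRM ler_expR /u [leLHS](_ : _ = x `^ r / c)//.
by field; rewrite !gt_eqF.
Qed.

End SubWeibull.

(** * Even moments after recentring *)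

Section CenteredMoments.
Variables (R : realType) (r K L : R).
Hypothesis r_gt0 : 0 < r.
Hypothesis r_le2 : r <= 2.
Hypothesis K_gt0 : 0 < K.
Hypothesis L_gt0 : 0 < L.

(** The [4] is the price of recentring, the power of [2 L / r] comes from [pow_le_fact_expR], and
    the [1] added to the exponential moment lets a single factor be absorbed into any positive
    power. *)
Definition moment_scale : R :=
  4 * (2 * L / r) `^ (2 / r) * (1 + exp_moment_bound K).

Lemma moment_scale_ge0 : 0 <= moment_scale.
Proof.
by rewrite mulr_ge0 ?mulr_ge0 ?powR_ge0// addr_ge0// exp_moment_bound_ge0.
Qed.

(** Equivalent to [(a!)^2 <= (2a)!]. It splits [((2a)!)^(1/r)] into the two factors of
    [moment_bound]. *)
Lemma sqrt_fact_le (a : nat) : (a.*2)`!%:R `^ 2^-1 <= (a.*2)`!%:R / a`!%:R :> R.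
Proof.
have n0 (k : nat) : 0 < k`!%:R :> R by rewrite ltr0n fact_gt0.
rewrite ler_pdivlMr//.
have e2 : (a.*2)`!%:R = (a.*2)`!%:R `^ 2^-1 * (a.*2)`!%:R `^ 2^-1 :> R.
  by rewrite -powRD ?gt_eqF ?implybT// (_ : 2^-1 + 2^-1 = 1) ?powRr1//; lra.
rewrite [leRHS]e2; apply: ler_wpM2l; first exact: powR_ge0.
have h : a`!%:R ^+ 2 <= (a.*2)`!%:R :> R.
  rewrite -natrX ler_nat -mulnn -addnn.
  have /bin_fact <- : (a <= a + a)%N by rewrite leq_addr.
  by rewrite addnK leq_pmull// bin_gt0 leq_addr.
have h2 : 0 <= (2^-1 : R) by [].
apply: le_trans (le_powR2r h2 (exprn_ge0 _ (ltW (n0 a))) h).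
by rewrite -powR_mulrn ?(ltW (n0 _))// -powRrM divff ?powRr1 ?(ltW (n0 _))// pnatr_eq0.
Qed.

(** Convexity gives [(v - mean)^(2b) <= 4^b (v^(2b) + mean^(2b)) / 2], and Jensen bounds the power
    of the mean by the same uncentred moment. That moment is controlled by the exponential moment
    through [pow_le_fact_expR]. *)
Lemma centered_moment (S : finType) (mu v : S -> R) (a : nat) :
  (forall s, 0 <= mu s) -> \sum_s mu s = 1 ->
  \sum_s mu s * expR (`|v s| `^ r / (2 * L)) <= exp_moment_bound K ->
  \sum_s mu s * (v s - \sum_s' mu s' * v s') ^+ a.*2 <=
  moment_bound (r^-1 - 2^-1) a * moment_scale ^+ a.
Proof.
move=> mu0 mu1 He; set mean := \sum_s' mu s' * v s'.
case: a => [|a].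
  rewrite expr0 mulr1; under eq_bigr do rewrite expr0 mulr1.
  by rewrite mu1 /moment_bound fact0 powR1 divr1 mulr1.
set b := a.+1.
have Ce0 := exp_moment_bound_ge0 K_gt0.
set Ce := exp_moment_bound K in He Ce0 *.
have L20 : 0 < 2 * L by rewrite mulr_gt0.
have b0 : 0 < r^-1 by rewrite invr_gt0.
pose Q := \sum_s mu s * v s ^+ b.*2.
have QC : \sum_s mu s * (v s - mean) ^+ b.*2 <= 4 ^+ b * Q.
  have mid (x : R) : (x - mean) ^+ b.*2 <= 4 ^+ b * (2^-1 * x ^+ b.*2 + 2^-1 * mean ^+ b.*2).
    have := @even_pow_jensen R bool (fun=> 2^-1) (fun c => if c then x else - mean) b.
    rewrite !big_bool/= => /(_ (fun=> _)) H.
    have {}H : (2^-1 * x + 2^-1 * - mean) ^+ b.*2 <= 2^-1 * x ^+ b.*2 + 2^-1 * (- mean) ^+ b.*2.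
      by apply: H; lra.
    have -> : x - mean = 2 * (2^-1 * x + 2^-1 * - mean) by field.
    rewrite exprMn -mul2n exprM (_ : 2 ^+ 2 = 4 :> R); last by ring.
    apply: ler_wpM2l; first exact: exprn_ge0.
    by move: H; rewrite -mul2n !exprM sqrrN.
  apply: (le_trans (ler_sum _ (fun s _ => ler_wpM2l (mu0 s) (mid (v s))))).
  have -> : \sum_s mu s * (4 ^+ b * (2^-1 * v s ^+ b.*2 + 2^-1 * mean ^+ b.*2)) =
      4 ^+ b * (2^-1 * Q + 2^-1 * mean ^+ b.*2).
    rewrite /Q -[X in _ + _ * X]mul1r -mu1 mulr_suml !mulr_sumr -big_split/= mulr_sumr.
    by apply: eq_bigr => s _; ring.
  apply: ler_wpM2l; first exact: exprn_ge0.
  have := even_pow_jensen v b mu0 mu1; rewrite -/Q -/mean; lra.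
apply: (le_trans QC).
have Qb : Q <= (2 * L / r) `^ (b.*2%:R / r) * (b.*2)`!%:R `^ r^-1 * Ce.
  apply: (@le_trans _ _ ((2 * L / r) `^ (b.*2%:R / r) * (b.*2)`!%:R `^ r^-1 *
      \sum_s mu s * expR (`|v s| `^ r / (2 * L)))); last first.
    by apply: ler_wpM2l => //; rewrite mulr_ge0 ?powR_ge0.
  rewrite mulr_sumr; apply: ler_sum => s _; rewrite [leRHS]mulrCA; apply: ler_wpM2l => //.
  have -> : v s ^+ b.*2 = `|v s| ^+ b.*2.
    by rewrite -mul2n !exprM real_normK// num_real.
  exact: pow_le_fact_expR.
apply: (le_trans (ler_wpM2l (exprn_ge0 b (ler0n R 4)) Qb)).
have -> : 4 ^+ b * ((2 * L / r) `^ (b.*2%:R / r) * (b.*2)`!%:R `^ r^-1 * Ce) =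
    (b.*2)`!%:R `^ r^-1 * ((4 * (2 * L / r) `^ (2 / r)) ^+ b * Ce).
  have -> : (2 * L / r) `^ (b.*2%:R / r) = ((2 * L / r) `^ (2 / r)) ^+ b.
    rewrite -powR_mulrn ?powR_ge0// -powRrM -muln2 natrM; congr (_ `^ _).
    by field; rewrite gt_eqF.
  by rewrite exprMn; ring.
apply: ler_pM; rewrite ?powR_ge0//.
- by rewrite mulr_ge0// exprn_ge0// mulr_ge0// powR_ge0.
- have -> : r^-1 = (r^-1 - 2^-1) + 2^-1 by ring.
  rewrite powRD; last by rewrite pnatr_eq0 -lt0n fact_gt0 implybT.
  rewrite addrK /moment_bound; apply: ler_wpM2l; first exact: powR_ge0.
  exact: sqrt_fact_le.
rewrite /moment_scale -/Ce [leRHS]exprMn; apply: ler_wpM2l.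
  by rewrite exprn_ge0// mulr_ge0// powR_ge0.
apply: (@le_trans _ _ (1 + Ce)); first by rewrite lerDr.
by rewrite /b exprS ler_peMr ?addr_ge0// exprn_ege1// lerDl.
Qed.

End CenteredMoments.

(** * One rounded entry: error, mean and exponential moment *)

Section RoundedVariable.
Context d (T : measurableType d) (R : realType) (P : probability T R).
Variables (r K L : R) (N : nat) (X : T -> R).
Hypothesis r_gt0 : 0 < r.
Hypothesis K_gt0 : 0 < K.
Hypothesis L_gt0 : 0 < L.
Hypothesis N_ge2 : (2 <= N)%N.
Hypothesis mX : measurable_fun setT X.
Hypothesis iX : P.-integrable setT (EFin \o X).
Hypothesis X_mean0 : (\int[P]_w (X w)%:E = 0)%E.
Hypothesis X_tail : forall t, 0 <= t ->
  (P [set w | (t <= `|X w|)%R] <= (K * expR (- (t `^ r / L)))%:E)%E.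

(* Chosen so that [expR (- (trunc_level ^ r) / (4 * L)) = 1 / N]. *)
Definition trunc_level : R := (4 * L * ln N%:R) `^ r^-1.
Definition grid_step : R := N%:R^-1.
Definition error_const : R := 1 + (4 * L / r) `^ r^-1 * exp_moment_bound K.

Let cell := @round_cell R trunc_level grid_step.
Let val := @cell_value R trunc_level grid_step.
Let prob s := fine (P (X @^-1` (cell @^-1` [set s]))).

Lemma trunc_level_gt0 : 0 < trunc_level.
Proof.
apply/powR_gt0/mulr_gt0; first by rewrite mulr_gt0.
by apply: lt_le_trans (ln_ge_half R N_ge2).
Qed.

Lemma grid_steexponent_gt0 : 0 < grid_step.
Proof. by rewrite invr_gt0 ltr0n; exact: ltn_trans N_ge2. Qed.

(** Below the truncation level the error is at most the grid step [1/N]. Above it the rounded value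
    is [0] and the error is [|x|], at most a constant times [exp (|x|^r / (4 L))]. A second such
    exponential is at least [N] by the choice of the level, which yields the factor [1/N]. *)
Lemma round_error_le (x : R) : `|x - val (cell x)| <=
  N%:R^-1 * (1 + (4 * L / r) `^ r^-1 * expR (`|x| `^ r / (2 * L))).
Proof.
have N0 : 0 < N%:R :> R by rewrite ltr0n; exact: ltn_trans N_ge2.
have [xM|xM] := leP `|x| trunc_level.
  apply: (le_trans (round_dist grid_steexponent_gt0 xM)).
  rewrite /grid_step ler_peMr ?invr_ge0 ?ler0n// lerDl.
  by rewrite mulr_ge0 ?powR_ge0 ?expR_ge0.
rewrite /val /cell round_out// subr0.
have L40 : 0 < 4 * L by rewrite mulr_gt0.
have := @pow_le_fact_expR R r r_gt0 (4 * L) `|x| 1 L40 (normr_ge0 x).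
rewrite expr1 factS fact0 muln1 powR1 mulr1 div1r => /le_trans; apply.
rewrite mulrDr mulr1 -[leLHS]add0r; apply: lerD; first by rewrite invr_ge0 ltW.
rewrite mulrCA; apply: ler_wpM2l; first exact: powR_ge0.
have -> : `|x| `^ r / (2 * L) = `|x| `^ r / (4 * L) + `|x| `^ r / (4 * L).
  by field; rewrite gt_eqF.
rewrite expRD mulrA ler_peMl ?expR_ge0// mulrC ler_pdivlMr// mul1r.
rewrite -[leLHS]lnK ?posrE// ler_expR ler_pdivlMr// mulrC.
have ln0 : 0 <= ln N%:R :> R by apply: ltW; apply: lt_le_trans (ln_ge_half R N_ge2).
have -> : 4 * L * ln N%:R = trunc_level `^ r.
  rewrite /trunc_level -powRrM mulVf ?gt_eqF// powRr1//.
  by apply: mulr_ge0 => //; exact: ltW.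
by apply: le_powR2r; [exact: ltW|exact: powR_ge0|exact: ltW].
Qed.

Lemma measurable_cell s : measurable (cell @^-1` [set s]).
Proof. exact: measurable_round_cell grid_steexponent_gt0 s. Qed.

Lemma measurable_X_cell s : measurable (X @^-1` (cell @^-1` [set s])).
Proof. by rewrite -[X in measurable X]setTI; exact: mX measurableT _ (measurable_cell s). Qed.

Lemma measurable_round : measurable_fun setT (fun w => (val (cell (X w)))%:E).
Proof. exact: (@measurable_finite_valued _ _ _ _ (fun w => cell (X w)) val measurable_X_cell). Qed.

Lemma round_error : (\int[P]_w (`|X w - val (cell (X w))|)%:E <=
  (N%:R^-1 * error_const)%:E)%E.
Proof.
have N0 : 0 <= N%:R^-1 :> R by rewrite invr_ge0.
have mE : measurable_fun setT (fun w => (expR (`|X w| `^ r / (2 * L)))%:E).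
  apply/measurable_EFinP; apply: measurableT_comp => //.
  apply: measurable_funM => //.
  apply: (@measurableT_comp _ _ _ _ _ _ (fun x : R => x `^ r)).
    exact: measurable_powR.
  by apply: measurableT_comp.
have C0 : 0 <= (4 * L / r) `^ r^-1 by exact: powR_ge0.
apply: (@le_trans _ _ (\int[P]_w ((N%:R^-1)%:E * (1%:E + ((4 * L / r) `^ r^-1)%:E *
    (expR (`|X w| `^ r / (2 * L)))%:E)))%E).
  apply: ge0_integral_mono => w; first by rewrite lee_fin.
  by have := round_error_le (X w); rewrite -lee_fin EFinM EFinD EFinM.
have CE0 w : (0 <= ((4 * L / r) `^ r^-1)%:E * (expR (`|X w| `^ r / (2 * L)))%:E)%E.
  by rewrite -EFinM lee_fin mulr_ge0// expR_ge0.
rewrite ge0_integralZl_EFin//; last 2 first.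
- by move=> w _; rewrite adde_ge0.
- by apply: emeasurable_funD => //; exact: measurable_funeM.
rewrite EFinM; apply: lee_wpmul2l; first by rewrite lee_fin.
rewrite ge0_integralD//; last exact: measurable_funeM.
rewrite ge0_integralZl_EFin//.
have -> : (\int[P]_w (1 : R)%:E = 1)%E.
  by rewrite integral_cst// mul1e; exact: probability_setT.
rewrite /error_const EFinD EFinM leeD2l// lee_wpmul2l ?lee_fin//.
exact: exp_moment_le.
Qed.

(** As [X] has mean zero, the mean of the rounded variable is that of the rounding error: recentring
    costs no more than rounding. *)
Lemma round_mean : `|\sum_s prob s * val s| <= N%:R^-1 * error_const.
Proof.
rewrite -lee_fin; apply: le_trans round_error.
have mE := measurable_round.
have e1 : (\int[P]_w (val (cell (X w)))%:E = (\sum_s prob s * val s)%:E)%E.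
  exact: (@integral_finite_valued_signed _ _ _ P _ (fun w => cell (X w)) val measurable_X_cell).
have iV : P.-integrable setT (EFin \o (fun w => val (cell (X w)))).
  apply: measurable_bounded_integrable => //.
  - by apply: (le_lt_trans (probability_le1 _ _)); rewrite ?ltry.
  - exact/measurable_EFinP.
  exists trunc_level; split; first exact: num_real.
  move=> x xM w _ /=; apply: le_trans (ltW xM).
  exact: (cell_value_le (ltW trunc_level_gt0) grid_steexponent_gt0).
have -> : (`|\sum_s prob s * val s|%:E = `|\int[P]_w ((val (cell (X w)))%:E - (X w)%:E)|)%E.
  by rewrite (integralB measurableT iV iX) e1 [X in (_ - X)%E]X_mean0 sube0.
apply: (le_trans (le_abse_integral _ _ _)) => //.
  by apply: emeasurable_funB => //; exact/measurable_EFinP.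
apply: ge0_integral_mono => w; first exact: abse_ge0.
by rewrite -EFinB lee_fin distrC.
Qed.

Lemma round_exp_moment : \sum_s prob s * expR (`|val s| `^ r / (2 * L)) <= exp_moment_bound K.
Proof.
rewrite -lee_fin.
rewrite -(@integral_finite_valued _ _ _ P _ (fun w => cell (X w))
  (fun s => expR (`|val s| `^ r / (2 * L))) measurable_X_cell); last first.
  by move=> s; exact: expR_ge0.
apply: le_trans (exp_moment_le r_gt0 K_gt0 L_gt0 mX X_tail).
apply: ge0_integral_mono => w; first by rewrite lee_fin expR_ge0.
rewrite lee_fin ler_expR ler_pM2r ?invr_gt0 ?mulr_gt0//.
by apply: le_powR2r; rewrite ?(ltW r_gt0)//; exact: (round_le _ grid_steexponent_gt0).
Qed.

Lemma sum_prob : \sum_s prob s = 1.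
Proof. exact: (@sum_cell_probability _ _ _ P _ (fun w => cell (X w)) measurable_X_cell). Qed.

End RoundedVariable.

(** * The theorem *)

Section EntryBounds.
Variables (R : realType) (m n : nat) (A : 'M[R]_(m, n)) (p q : R).
Hypothesis p_ge1 : 1 <= p.
Hypothesis q_ge1 : 1 <= q.

Lemma dual_ball_entry w (i : 'I_m) : dual_ball q w -> `|w i| <= 1.
Proof.
move=> wb; have h : `|w i ^+ 2| <= 1.
  by apply: le_trans wb; apply: (le_lnorm (fun i => w i ^+ 2)); exact: ehalf_hconj_gt0.
by move: h; rewrite normrX -{1}(expr1n R 2) ler_pXn2r ?nnegrE.
Qed.

(** A crude bound with every coordinate of [x] and of the dual vector at most one. It is affordable
    because it is applied only to errors of mean size [1/(mn)]. *)
Lemma lnorm_bilin_le h (x : 'I_n -> R) : lnorm p%:E x <= 1 ->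
  lnorm q%:E (bilin A h x) <= \sum_(k : 'I_m * 'I_n) `|A k.1 k.2| * `|h k|.
Proof.
move=> x1; have [w wb ->] := dual_attained (bilin A h x) q_ge1.
rewrite sum_entries; apply: ler_sum => i _; rewrite /bilin mulr_suml.
apply: ler_sum => j _ /=; apply: le_trans (ler_norm _) _.
rewrite !normrM -[leRHS]mulr1; apply: ler_pM => //; last exact: dual_ball_entry.
rewrite -[leRHS]mulr1; apply: ler_wpM2l => //; apply: le_trans x1.
by apply: le_lnorm; rewrite lte_fin; exact: lt_le_trans p_ge1.
Qed.

(** Test on a basis vector. The bound weights the rounding errors, and shows that [A] vanishes when
    [S2 = 0]. *)
Lemma entry_le_dual_opnorm (S2 : R) i j :
  (forall x, lnorm (ehalf (hconj q)) x <= 1 ->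
     lnorm (ehalf (hconj p)) (mxapp (hsq A)^T x) <= S2) ->
  A i j ^+ 2 <= S2.
Proof.
move=> H; pose e (k : 'I_m) : R := (k == i)%:R.
have q0 : 0 < q by exact: lt_le_trans q_ge1.
have eb : dual_ball q e.
  have [q1|qn1] := eqVneq q 1.
    by rewrite q1; apply/dual_ball1 => k; rewrite /e; case: (k == i); rewrite ?normr1 ?normr0.
  have q1' : 1 < q by rewrite lt_neqAle eq_sym qn1.
  apply/(dual_ball_gt1 _ q1'); rewrite (bigD1 i)//= big1 => [|k ki].
    by rewrite /e eqxx normr1 powR1 addr0.
  by rewrite /e (negbTE ki) normr0 powR0// mulf_neq0 ?gt_eqF// invr_gt0 subr_gt0.
have := H _ eb; apply: le_trans.
have -> : A i j ^+ 2 = mxapp (hsq A)^T (fun k => e k ^+ 2) j.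
  rewrite /mxapp (bigD1 i)//= big1 => [|k ki]; last by rewrite /e (negbTE ki) expr0n mulr0.
  by rewrite !mxE /e eqxx expr1n mulr1 addr0.
apply: le_trans (ler_norm _) _; apply: le_lnorm; exact: ehalf_hconj_gt0.
Qed.

Lemma lnorm_mxapp_le_opnorm (s t : \bar R) (B : 'M[R]_(m, n)) S : opnorm s t B = S%:E ->
  forall x, lnorm s x <= 1 -> lnorm t (mxapp B x) <= S.
Proof.
by move=> BS x x1; rewrite -lee_fin -BS; apply: ereal_sup_ubound; exists x.
Qed.

Lemma opnorm_ge0 (s t : \bar R) (B : 'M[R]_(m, n)) : (0 < s)%E -> (0 <= opnorm s t B)%E.
Proof.
move=> s0; apply: (@le_trans _ _ (lnorm t (mxapp B (fun=> 0)))%:E).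
  by rewrite lee_fin lnorm_ge0.
apply: ereal_sup_ubound; exists (fun=> 0) => //=.
case: s s0 => [s| |]//=; last first.
  by move=> _; apply: bigmax_le => // j _; rewrite normr0.
by rewrite lte_fin => s0; have := @lnorm0 R n s s0; rewrite /= => ->.
Qed.

End EntryBounds.

(** * From rounded entries to the original ones *)

Section Transfer.
Variables (R : realType) (r K L : R).
Hypothesis K_gt0 : 0 < K.
Hypothesis L_gt0 : 0 < L.
Hypothesis r_gt0 : 0 < r.
Hypothesis r_le2 : r <= 2.

Lemma expected_opnorm_le d (T : measurableType d) (P : probability T R)
    (m n : nat) (p q S1 S2 : R) (A : 'M[R]_(m, n)) (X : 'I_m * 'I_n -> T -> R) :
  (2 <= m)%N -> (2 <= n)%N -> 1 <= p -> p <= 2 -> 1 <= q ->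
  (forall k, measurable_fun setT (X k)) ->
  mutually_independent P X ->
  (forall k, P.-integrable setT (EFin \o X k)) ->
  (forall k, (\int[P]_w (X k w)%:E = 0)%E) ->
  (forall k (t : R), 0 <= t ->
    (P [set w | (t <= `|X k w|)%R] <= (K * expR (- (t `^ r / L)))%:E)%E) ->
  0 <= S1 -> 0 < S2 ->
  (forall x, lnorm (p / 2)%:E x <= 1 -> lnorm (q / 2)%:E (mxapp (hsq A) x) <= S1) ->
  (forall x, lnorm (ehalf (hconj q)) x <= 1 ->
     lnorm (ehalf (hconj p)) (mxapp (hsq A)^T x) <= S2) ->
  (\int[P]_w opnorm p%:E q%:E (XA A (fun i j => X (i, j)) w) <=
   ((3 * ln n%:R) `^ (1 - p^-1) *
     (mean_bound q S1 (r^-1 - 2^-1) (moment_scale r K L) +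
      49 * deviation_scale n S2 (trunc_level r L (m * n))) +
    2 * error_const r K L * S2 `^ 2^-1)%:E)%E.
Proof.
move=> m2 n2 p1 p2 q1 mX indX iX X0 tailX S10 S20 AS1 AS2.
have p0 : 0 < p by exact: lt_le_trans p1.
set N := (m * n)%N; have N2 : (2 <= N)%N by rewrite (leq_trans n2)// leq_pmull// (ltn_trans _ m2).
have N0 : 0 < N%:R :> R by rewrite ltr0n (ltn_trans _ N2).
set M := trunc_level r L N; have M0 : 0 < M by exact: trunc_level_gt0.
set dl := grid_step R N; have dl0 : 0 < dl by exact: grid_steexponent_gt0.
pose cell := @round_cell R M dl.
pose val := @cell_value R M dl.
pose mu k s := fine (P (X k @^-1` (cell @^-1` [set s]))).
pose mean k := \sum_s mu k s * val s.
pose v k s := val s - mean k.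
set e1 := error_const r K L.
have mu0 k s : 0 <= mu k s by exact: fine_ge0.
have mu1 k : \sum_s mu k s = 1.
  exact: (@sum_prob _ _ _ P r L N (X k) N2 (mX k)).
have v0 k : \sum_s mu k s * v k s = 0.
  under eq_bigr do rewrite mulrBr.
  by rewrite sumrB -mulr_suml mu1 mul1r /mean subrr.
(* The condition [r <= 2] supplies the nonnegative [beta] that [moment_bound_mul] requires. *)
have b0 : 0 <= r^-1 - 2^-1 by rewrite subr_ge0 lef_pV2 ?posrE.
have D0 := moment_scale_ge0 r L K_gt0.
have vm k a : \sum_s mu k s * v k s ^+ a.*2 <=
    moment_bound (r^-1 - 2^-1) a * moment_scale r K L ^+ a.
  apply: centered_moment => //.
  exact: (@round_exp_moment _ _ _ P r K L N (X k) r_gt0 K_gt0 L_gt0 N2 (mX k) (tailX k)).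
have vd k s s' : (v k s - v k s') ^+ 2 <= (2 * M) ^+ 2.
  rewrite -real_normK ?num_real//; apply: lerXn2r; rewrite ?nnegrE ?mulr_ge0 ?(ltW M0)//.
  rewrite /v opprB addrA subrK (_ : 2 * M = M + M); last by ring.
  by apply: le_trans (ler_normB _ _) _; apply: lerD; exact: (cell_value_le (ltW M0) dl0).
have [Bf [Bf1 Bf2]] := expect_opnorm_bound p1 p2 q1 S10 S20 AS1 AS2 mu0 mu1 v0 b0 D0 vm
  M0 vd n2 (fun=> 0).
have Bf0 z : 0 <= Bf z.
  apply: le_trans (Bf1 z (fun=> 0) _); first exact: lnorm_ge0.
  by rewrite lnorm0.
have e10 : 0 <= e1.
  by rewrite addr_ge0// mulr_ge0 ?powR_ge0// exp_moment_bound_ge0.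
pose Y w k := v k (cell (X k w)).
pose err (k : 'I_m * 'I_n) w := S2 `^ 2^-1 * (`|X k w - val (cell (X k w))| + N%:R^-1 * e1).
have S2h : 0 <= S2 `^ 2^-1 by exact: powR_ge0.
have ce0 : 0 <= N%:R^-1 * e1 by rewrite mulr_ge0// invr_ge0 ltW.
have err0 k w : 0 <= err k w by rewrite mulr_ge0// addr_ge0.
have entry k : `|A k.1 k.2| <= S2 `^ 2^-1.
  have h2 : 0 <= (2^-1 : R) by [].
  have := le_powR2r h2 (sqr_ge0 _) (entry_le_dual_opnorm p1 q1 k.1 k.2 AS2).
  by rewrite -real_normK ?num_real// -powR_mulrn// -powRrM divff// powRr1.
(* Write [X = Y + (X - Y)]: the majorant handles [Y], and the remainder is summed entry by entry.
   The second term of [err] pays for the recentring. *)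
have pw w : (opnorm p%:E q%:E (XA A (fun i j => X (i, j)) w) <=
    (Bf (Y w))%:E + \sum_(k <- index_enum ('I_m * 'I_n)%type) (err k w)%:E)%E.
  apply: ge_ereal_sup => _ [x x1 <-]; rewrite sumEFin -EFinD lee_fin.
  have -> : mxapp (XA A (fun i j => X (i, j)) w) x =
     (fun i => bilin A (Y w) x i + bilin A (fun k => X k w - Y w k) x i).
    apply/funext => i; rewrite /mxapp /bilin -big_split/=; apply: eq_bigr => j _.
    by rewrite /XA mxE; ring.
  apply: le_trans (lnormD _ _ q1) _; apply: lerD; first exact: Bf1.
  apply: (le_trans (lnorm_bilin_le A p1 q1 _ x1)); apply: ler_sum => k _.
  apply: ler_pM => //; rewrite /Y /v opprB addrA addrAC.
  apply: le_trans (ler_normD _ _) _; apply: lerD => //.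
  exact: (@round_mean _ _ _ P r K L N (X k) r_gt0 K_gt0 L_gt0 N2 (mX k) (iX k) (X0 k) (tailX k)).
have mcell (k : 'I_m * 'I_n) s : measurable (cell @^-1` [set s]).
  exact: (measurable_round_cell dl0).
have mval k : measurable_fun setT (fun w => val (cell (X k w))).
  by apply/measurable_EFinP; exact: (measurable_round r L N2 (mX k)).
have mB : measurable_fun setT (fun w => (Bf (Y w))%:E).
  have -> : (fun w => (Bf (Y w))%:E) =
      (fun w => (Bf (fun k => v k ([ffun k => cell (X k w)] k)))%:E).
    apply/funext => w; congr (Bf _)%:E; apply/funext => k; by rewrite ffunE.
  apply: (@measurable_finite_valued _ _ _ _ (fun w => [ffun k => cell (X k w)])
    (fun g : {ffun _ -> _} => Bf (fun k => v k (g k)))) => g.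
  exact: (@measurable_joint_cell _ T R _ _ X (fun=> cell) g mX mcell).
have mab k : measurable_fun setT (fun w => `|X k w - val (cell (X k w))|).
  by apply: measurableT_comp => //; exact: measurable_funB.
have merr k : measurable_fun setT (fun w => (err k w)%:E).
  apply/measurable_EFinP; apply: measurable_funM => //.
  exact: measurable_funD.
have opn0 w : (0 <= opnorm p%:E q%:E (XA A (fun i j => X (i, j)) w))%E.
  by apply: opnorm_ge0; rewrite lte_fin.
apply: (le_trans (ge0_integral_mono P opn0 pw)).
rewrite ge0_integralD//; last 3 first.
- by move=> w _; rewrite lee_fin.
- by move=> w _; apply: sume_ge0 => k _; rewrite lee_fin.
- by apply: emeasurable_sum => k; exact: merr.
rewrite EFinD; apply: leeD.
  rewrite (_ : (\int[P]_w (Bf (Y w))%:E)%E = (expect mu v (enum {: 'I_m * 'I_n}) Bf (fun=> 0))%:E).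
    by rewrite lee_fin.
  exact: (integral_independent v (fun=> 0) mX mcell indX Bf0).
rewrite ge0_integral_sum//; last by move=> k w _; rewrite lee_fin.
(* Each of the [N = m * n] entries contributes two errors of size [e1 / N], so [N] cancels. *)
apply: (@le_trans _ _ (\sum_(k <- index_enum ('I_m * 'I_n)%type)
   (S2 `^ 2^-1 * (N%:R^-1 * e1 + N%:R^-1 * e1))%:E)%E).
  apply: lee_sum => k _; under eq_integral do rewrite /err EFinM.
  rewrite ge0_integralZl_EFin//; last 2 first.
  - by move=> w _; rewrite lee_fin addr_ge0.
  - by apply/measurable_EFinP; exact: measurable_funD.
  rewrite [leRHS]EFinM; apply: lee_wpmul2l; first by rewrite lee_fin.
  under eq_integral do rewrite EFinD.
  rewrite ge0_integralD//; last exact/measurable_EFinP.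
  rewrite EFinD; apply: leeD.
    exact: (@round_error _ _ _ P r K L N (X k) r_gt0 K_gt0 L_gt0 N2 (mX k) (tailX k)).
  rewrite integral_cst// -[leRHS]mule1; apply: lee_wpmul2l; first by rewrite lee_fin.
  exact: probability_le1.
rewrite sumEFin lee_fin sumr_const card_prod !card_ord -/N -mulr_natl.
rewrite le_eqVlt; apply/orP; left; apply/eqP; field.
by rewrite gt_eqF.
Qed.

(** The [3] bounds [3^(1 - 1/p)], [147] is [3 * 49], and [4] is twice the [2] in front of the
    rounding error. *)
Definition theorem_const : R :=
  3 * (3 `^ r^-1 * (4 * moment_scale r K L) `^ 2^-1) +
  147 * (4 * L) `^ r^-1 + 4 * error_const r K L.

Lemma error_const_gt0 : 0 < error_const r K L.
Proof.
rewrite /error_const (lt_le_trans ltr01)// lerDl.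
by rewrite mulr_ge0 ?powR_ge0// exp_moment_bound_ge0.
Qed.

Lemma theorem_const_gt0 : 0 < theorem_const.
Proof.
have e := error_const_gt0; rewrite /theorem_const ltr_wpDl// ?mulr_gt0//.
by rewrite addr_ge0// !mulr_ge0// powR_ge0.
Qed.

Lemma theorem_const_bound (m n : nat) (p q S1 S2 : R) :
  (2 <= m)%N -> (2 <= n)%N -> 1 <= p -> p <= 2 -> 1 <= q -> 0 <= S1 -> 0 <= S2 ->
  (3 * ln n%:R) `^ (1 - p^-1) *
     (mean_bound q S1 (r^-1 - 2^-1) (moment_scale r K L) +
      49 * deviation_scale n S2 (trunc_level r L (m * n))) +
    2 * error_const r K L * S2 `^ 2^-1 <=
  theorem_const * (q `^ r^-1 * ln n%:R `^ (1 - p^-1) * S1 `^ 2^-1 +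
    ln n%:R `^ (2^-1 + (1 - p^-1)) * ln (m * n)%:R `^ r^-1 * S2 `^ 2^-1).
Proof.
move=> m2 n2 p1 p2 q1 S10 S20.
have p0 : 0 < p by exact: lt_le_trans p1.
have l0 : 2^-1 <= ln n%:R :> R by exact: ln_ge_half.
have N1 : 1 <= ln (m * n)%:R :> R by apply: ln_ge_one; rewrite (@leq_mul 2 2).
set l := ln n%:R in l0 *; set N := ln (m * n)%:R in N1 *.
have lp : 0 < l by exact: lt_le_trans l0.
have Np : 0 < N by exact: lt_le_trans N1.
have ip : 2^-1 <= p^-1 by rewrite lef_pV2 ?posrE.
have ip1 : p^-1 <= 1 by rewrite invf_le1.
have i0 : 0 <= r^-1 by rewrite invr_ge0 ltW.
set t := 1 - p^-1.
have t0 : 0 <= t by rewrite /t; lra.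
have t1 : t <= 2^-1 by rewrite /t; lra.
have three : 3 `^ t <= 3 :> R.
  by rewrite -[leRHS]powRr1//; apply: ler_powR; lra.
rewrite powRM ?(ltW lp)//.
have -> : mean_bound q S1 (r^-1 - 2^-1) (moment_scale r K L) =
    3 `^ r^-1 * (4 * moment_scale r K L) `^ 2^-1 * (q `^ r^-1 * S1 `^ 2^-1).
  rewrite /mean_bound (_ : r^-1 - 2^-1 + 2^-1 = r^-1); last by rewrite subrK.
  by rewrite (@powRM _ 3 q)//; [ring|lra].
have -> : deviation_scale n S2 (trunc_level r L (m * n)) =
    (4 * L) `^ r^-1 * (l `^ 2^-1 * N `^ r^-1 * S2 `^ 2^-1).
  rewrite /deviation_scale /trunc_level -/l -/N powRM ?(ltW Np)//; first by ring.
  by rewrite mulr_ge0// ltW.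
have lD : l `^ (2^-1 + t) = l `^ 2^-1 * l `^ t.
  by rewrite powRD// (lt0r_neq0 lp) implybT.
have half : 2^-1 <= l `^ (2^-1 + t).
  apply: (@le_trans _ _ (2^-1 `^ (2^-1 + t))).
    by apply: powR_le_self; lra.
  by apply: le_powR2r; [lra|lra|exact: l0].
have Nr : 1 <= N `^ r^-1.
  by have := le_powR2r i0 ler01 N1; rewrite powR1.
rewrite lD in half *.
have e0 := error_const_gt0.
rewrite /theorem_const.
set c1 := 3 `^ r^-1 * _; set c2 := (4 * L) `^ _; set c3 := error_const r K L in e0 *.
have c10 : 0 <= c1 by rewrite mulr_ge0 ?powR_ge0.
have c20 : 0 <= c2 by exact: powR_ge0.
set s1 := S1 `^ _; set s2 := S2 `^ _.
have s10 : 0 <= s1 by exact: powR_ge0.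
have s20 : 0 <= s2 by exact: powR_ge0.
have qr0 : 0 <= q `^ r^-1 by exact: powR_ge0.
have lt0 : 0 <= l `^ t by exact: powR_ge0.
have lh0 : 0 <= l `^ 2^-1 by exact: powR_ge0.
move: three half Nr qr0 lt0 lh0.
move: (3 `^ t) (l `^ t) (l `^ 2^-1) (N `^ r^-1) (q `^ r^-1) => a b h y x.
move=> a3 hb y1 x0 b0 h0.
pose U := x * b * s1; pose V := h * b * y * s2.
have U0 : 0 <= U by rewrite !mulr_ge0.
have y0 : 0 <= y by exact: le_trans y1.
have V0 : 0 <= V by rewrite !mulr_ge0.
have sV : s2 <= 2 * V.
  have : 2^-1 * 1 <= h * b * y by apply: ler_pM.
  by move=> hh; have := ler_wpM2r s20 hh; rewrite /V; lra.
have h1 : a * (c1 * U) <= 3 * (c1 * U) by apply: ler_wpM2r => //; exact: mulr_ge0.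
have h2 : a * (c2 * V) <= 3 * (c2 * V) by apply: ler_wpM2r => //; exact: mulr_ge0.
have h3 : c3 * s2 <= c3 * (2 * V) by apply: ler_wpM2l => //; exact: ltW.
have h4 : 0 <= (3 * c1) * V by apply: mulr_ge0 => //; exact: mulr_ge0.
have h5 : 0 <= (147 * c2 + 4 * c3) * U.
  apply: mulr_ge0 => //; apply: addr_ge0; first exact: mulr_ge0.
  by apply: mulr_ge0 => //; exact: ltW.
rewrite [leLHS](_ : _ = a * (c1 * U) + 49 * (a * (c2 * V)) + 2 * (c3 * s2)); last first.
  by rewrite /U /V; ring.
rewrite -/U [X in _ <= _ * (_ + X)](_ : _ = V); last by rewrite /V; ring.
by lra.
Qed.

End Transfer.

Theorem theorem1p17 (R : realType) (r K L : R) :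
  0 < K -> 0 < L -> 0 < r -> r <= 2 ->
  exists C : R, 0 < C /\
  forall (d : measure_display) (T : measurableType d) (P : probability T R)
    (m n : nat) (p q : R) (A : 'M[R]_(m, n)) (X : 'I_m -> 'I_n -> {RV P >-> R}),
    (2 <= m)%N -> (2 <= n)%N -> 1 <= p -> p <= 2 -> 1 <= q ->
    mutually_independent P (fun k : 'I_m * 'I_n => (X k.1 k.2 : T -> R)) ->
    (forall i j, P.-integrable setT (EFin \o (X i j : T -> R))) ->
    (forall i j, ('E_P[X i j] = 0)%E) ->
    (forall i j (t : R), 0 <= t ->
        (P [set w | (t <= `|X i j w|)%R] <= (K * expR (- (powR t r / L)))%:E)%E) ->
    (\int[P]_w opnorm (EFin p) (EFin q)
        (XA A (fun i j => (X i j : T -> R)) w)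
     <= C%:E *
        ((powR q r^-1 * powR (ln n%:R) (1 - p^-1))%R%:E
           * (opnorm (EFin (p / 2)%R) (EFin (q / 2)%R) (hsq A)) `^ (2^-1)%R
         + (powR (ln n%:R) (2^-1 + (1 - p^-1)) * powR (ln (m * n)%:R) r^-1)%R%:E
           * (opnorm (ehalf (hconj q)) (ehalf (hconj p)) (hsq A)^T) `^ (2^-1)%R))%E.
Proof.
move=> K0 L0 r0 r2; exists (theorem_const r K L); split; first exact: theorem_const_gt0.
move=> d T P m n p q A X m2 n2 p1 p2 q1 indX iX EX tailX.
have C0 : 0 < theorem_const r K L by exact: theorem_const_gt0.
have p0 : 0 < p by exact: lt_le_trans p1.
have q0 : 0 < q by exact: lt_le_trans q1.
have l0 : 0 < ln n%:R :> R by apply: lt_le_trans (ln_ge_half R n2).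
have N0 : 0 < ln (m * n)%:R :> R.
  by apply: lt_le_trans (ln_ge_one R _); rewrite ?(@leq_mul 2 2).
set a := powR q _ * _; set b := powR (ln n%:R) _ * _.
have a0 : 0 < a by rewrite mulr_gt0 ?powR_gt0.
have b0 : 0 < b by rewrite mulr_gt0 ?powR_gt0.
have h0 : (2^-1 : R) != 0 by rewrite invr_eq0 pnatr_eq0.
have := @opnorm_ge0 R m n (p / 2)%:E (q / 2)%:E (hsq A).
have := @opnorm_ge0 R n m (ehalf (hconj q)) (ehalf (hconj p)) (hsq A)^T.
rewrite lte_fin divr_gt0// ehalf_hconj_gt0// => /(_ isT) S20 /(_ isT) S10.
(* If either operator norm is infinite, the positive coefficients make the right-hand side [+oo]. *)
case E1 : (opnorm (p / 2)%:E _ _) S10 => [S1| |]// S10; last first.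
  rewrite poweRyr// gt0_muley ?lte_fin// addye; last first.
    by rewrite -ltNye (lt_le_trans (ltNyr 0))// mule_ge0 ?poweR_ge0// lee_fin ltW.
  by rewrite gt0_muley ?lte_fin// leey.
case E2 : (opnorm (ehalf _) _ _) S20 => [S2| |]// S20; last first.
  rewrite poweRyr// gt0_muley ?lte_fin// addey; last first.
    by rewrite -ltNye (lt_le_trans (ltNyr 0))// mule_ge0 ?poweR_ge0// lee_fin ltW.
  by rewrite gt0_muley ?lte_fin// leey.
rewrite !lee_fin in S10 S20.
rewrite !poweR_EFin -!EFinM.
have AS1 := lnorm_mxapp_le_opnorm E1.
have AS2 := lnorm_mxapp_le_opnorm E2.
(* The concentration argument divides by the deviation scale, so [S2 = 0] is treated apart: there
   [A = 0] and the integrand vanishes. *)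
have [S2z|S2n] := eqVneq S2 0.
  have A0 i j : A i j = 0.
    apply/eqP; rewrite -sqrf_eq0 eq_le sqr_ge0 andbT -S2z.
    exact: (entry_le_dual_opnorm p1 q1 i j AS2).
  apply: (@le_trans _ _ (\int[P]_w (0 : R)%:E)%E).
    apply: ge0_integral_mono => w; first by apply: opnorm_ge0; rewrite lte_fin.
    apply: ge_ereal_sup => _ [x _ <-]; rewrite lee_fin.
    rewrite (_ : mxapp _ _ = (fun=> 0)) ?lnorm0//.
    by apply/funext => i; apply: big1 => j _; rewrite mxE A0 !mul0r.
  rewrite integral0 lee_fin mulr_ge0 ?(ltW C0)//.
  by rewrite addr_ge0// mulr_ge0 ?powR_ge0// ltW.
have S2p : 0 < S2 by rewrite lt_neqAle eq_sym S2n.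
have mX (k : 'I_m * 'I_n) : measurable_fun setT (X k.1 k.2 : T -> R) by exact: measurable_funPT.
have X0 (k : 'I_m * 'I_n) : (\int[P]_w (X k.1 k.2 w)%:E = 0)%E.
  by rewrite -(EX k.1 k.2) expectation_def.
apply: (le_trans (expected_opnorm_le (X := fun k => X k.1 k.2) K0 L0 r0 r2 m2 n2 p1 p2 q1
  mX indX (fun k => iX k.1 k.2) X0 (fun k => tailX k.1 k.2) S10 S2p AS1 AS2)).
by rewrite lee_fin; exact: theorem_const_bound.
Qed.
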